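(* Let $G$ be a (Hausdorff) topological group definable in a first order structure $M$. Assume that $G$ has a basis of open neighborhoods of $e$ consisting of definable, open subgroups. If $G$ is definably topologically amenable, then ${G^*}^{00}_{\mathrm{def},\mathrm{top}}={G^*}^{000}_{\mathrm{def},\mathrm{top}}$.
   Context: Let $\mathcal L$ be the language of $M$ and let $\mathcal L'\supseteq \mathcal L$ be any language containing relation symbols whose interpretations in $M$ range over all open subsets of $G$. ''Definable'' means $\mathcal L$-definable with parameters from $M$. Let $\mathfrak C\succ M$ be a monster model both in the sense of $\mathcal L$ and of $\mathcal L'$ (i.e. $\kappa$-saturated and strongly $\kappa$-homogeneous for a sufficiently large strong limit cardinal $\kappa$). For a subset $D$ of $G$ definable in $\mathcal L'$, $D^*$ is its interpretation in $\mathfrak C$; in particular $G^*$ is the interpretation of $G$. ''Bounded index'' means index $<\kappa$. A subset is $M$-type-definable if it is an intersection of sets definable over $M$, and $M$-invariant if it is invariant under automorphisms of $\mathfrak C$ fixing $M$ pointwise (in the indicated language). Let $\mu=\bigcap\{U^*: U \text{ an open neighborhood of } e \text{ in } G\}$. Components: ${G^*}^{00}_{M}$ is the smallest subgroup of $G^*$ of bounded index that is $M$-type-definable in $\mathcal L$; ${G^*}^{000}_M$ is the smallest subgroup of $G^*$ of bounded index that is $M$-invariant in $\mathcal L$. ${G^*}^{00}_{\mathrm{top}}$ is the smallest bounded index subgroup of $G^*$ which is an intersection of some sets of the form $U^*$ with $U$ open in $G$. ${G^*}^{000}_{\mathrm{top}}$ is the smallest normal, bounded index subgroup of $G^*$ that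 is $M$-invariant in $\mathcal L'$ and contains $\mu$. Finally ${G^*}^{00}_{\mathrm{def},\mathrm{top}}:={G^*}^{00}_{\mathrm{top}}\cdot {G^*}^{00}_M$ and ${G^*}^{000}_{\mathrm{def},\mathrm{top}}:={G^*}^{000}_{\mathrm{top}}\cdot {G^*}^{000}_M$. Definable topological amenability: suppose $G$ has a basis of open neighborhoods of $e$ consisting of definable sets. Let $S_G(M)$ be the space of complete $\mathcal L$-types over $M$ concentrating on $G$, and $S_G^\mu(M)=S_G(M)/\!\sim_\mu$ with the quotient topology, where $p\sim_\mu q\iff \mu\cdot p(G^* )=\mu\cdot q(G^* )$ ($p(G^* )$ is the set of realizations of $p$). $S^\mu_G(M)$ is compact Hausdorff and $G$ acts on it by $g\cdot(p/\!\sim_\mu)=(gp)/\!\sim_\mu$. $G$ is definably topologically amenable if there is a left-invariant (i.e. $G$-invariant) Borel probability measure on $S_G^\mu(M)$. *)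

(* Defs.v *)
From HB Require Import structures.
From mathcomp Require Import all_boot all_order all_algebra.
From mathcomp Require Import all_classical all_reals all_analysis.

Set Implicit Arguments.
Unset Strict Implicit.
Unset Printing Implicit Defensive.

Local Open Scope classical_set_scope.
Local Open Scope card_scope.
Local Open Scope quotient_scope.

Record language := Language { funs : nat -> Type; rels : nat -> Type }.

Definition symbols (L : language) : Type :=
  ({n & funs L n} + {n & rels L n})%type.

Record sublanguage (L L' : language) := Sublanguage {
  incl_fun : forall n, funs L n -> funs L' n;
  incl_rel : forall n, rels L n -> rels L' n;
  incl_fun_inj : forall n, injective (@incl_fun n);
  incl_rel_inj : forall n, injective (@incl_rel n) }.

Record structure (L : language) := Structure {
  carrier :> Type;
  fun_interp : forall n, funs L n -> ('I_n -> carrier) -> carrier;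
  rel_interp : forall n, rels L n -> ('I_n -> carrier) -> Prop }.

Definition reduct (L L' : language) (i : sublanguage L L')
    (M : structure L') : structure L :=
  {| carrier := M;
     fun_interp := fun n f => fun_interp (incl_fun i f);
     rel_interp := fun n r => rel_interp (incl_rel i r) |}.

Inductive term (L : language) (V : Type) : Type :=
| Var of V
| App n of funs L n & ('I_n -> term L V).

(* [formula L V] has its free variables in [V]; [All] binds [None]. *)
Inductive formula (L : language) (V : Type) : Type :=
| Equal of term L V & term L V
| Rel n of rels L n & ('I_n -> term L V)
| Bot
| Imp of formula L V & formula L V
| All of formula L (option V).
Arguments Bot {L V}.

Definition Neg L (V : Type) (phi : formula L V) : formula L V := Imp phi Bot.

Fixpoint eval L (M : structure L) (V : Type) (x : V -> M) (t : term L V) : M :=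
  match t with
  | Var v => x v
  | App n f ts => fun_interp f (fun k => eval x (ts k))
  end.

Fixpoint sat L (M : structure L) (V : Type) (phi : formula L V) : (V -> M) -> Prop :=
  match phi with
  | Equal s t => fun x => eval x s = eval x t
  | Rel n r ts => fun x => rel_interp r (fun k => eval x (ts k))
  | Bot => fun _ => False
  | Imp psi chi => fun x => sat psi x -> sat chi x
  | All psi => fun x => forall d : M, sat psi (fun v => oapp x d v)
  end.

Definition vapp (T V W : Type) (x : V -> T) (y : W -> T) : V + W -> T :=
  fun v => match v with inl v => x v | inr w => y w end.

(* A formula in the variables [V] with parameters from [A] is a term of
   [formula L (V + A)]: the parameters are variables which an
   interpretation [a : A -> M] sends to the elements they name. *)
Definition satp L (M : structure L) (A : Type) (a : A -> M) (V : Type)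
    (phi : formula L (V + A)) (x : V -> M) : Prop :=
  sat phi (vapp x a).

Definition defines L (M : structure L) (V : Type) (phi : formula L (V + M))
    (D : set (V -> M)) : Prop :=
  D = [set x | satp idfun phi x].

Definition definable L (M : structure L) (V : Type) (D : set (V -> M)) : Prop :=
  exists phi, defines phi D.

Definition elementary L (M N : structure L) (j : M -> N) : Prop :=
  forall (V : Type) (phi : formula L V) (x : V -> M), sat phi x <-> sat phi (j \o x).

Definition automorphism L (M : structure L) (s : M -> M) : Prop :=
  [/\ bijective s,
      forall n (f : funs L n) x, s (fun_interp f x) = fun_interp f (s \o x) &
      forall n (r : rels L n) x, rel_interp r x <-> rel_interp r (s \o x)].

Definition realizes L (M : structure L) (A : Type) (a : A -> M) (V : Type)
    (p : set (formula L (V + A))) : set (V -> M) :=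
  [set x | forall phi, p phi -> satp a phi x].

Definition finitely_satisfiable L (M : structure L) (A : Type) (a : A -> M) (V : Type)
    (p : set (formula L (V + A))) : Prop :=
  forall F, F `<=` p -> finite_set F -> realizes a F !=set0.

Definition complete_type L (M : structure L) (V : Type)
    (p : set (formula L (V + M))) : Prop :=
  finitely_satisfiable (idfun : M -> M) p /\
  forall phi, p phi \/ p (Neg phi).

(* A cardinal kappa is represented by a type of that cardinality. *)
Definition card_lt (T : Type) (A : set T) (kappa : Type) : Prop :=
  A #<= [set: kappa] /\ ~ ([set: kappa] #<= A).

Definition strong_limit (kappa : Type) : Prop :=
  card_lt [set: nat] kappa /\
  forall A : set kappa, card_lt A kappa ->
    card_lt [set B : set kappa | B `<=` A] kappa.

Definition saturated (kappa : Type) L (N : structure L) : Prop :=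
  forall A : set N, card_lt A kappa ->
  forall n (p : set (formula L ('I_n + set_type A))),
    finitely_satisfiable (@set_val _ A) p -> realizes (@set_val _ A) p !=set0.

Definition strongly_homogeneous (kappa : Type) L (N : structure L) : Prop :=
  forall A : set N, card_lt A kappa ->
  forall f : set_type A -> N,
    (forall phi : formula L (set_type A),
       sat phi (@set_val _ A) <-> sat phi f) ->
  exists2 s : N -> N, automorphism s & forall a, s (set_val a) = f a.

Definition monster (kappa : Type) L (M N : structure L) (j : M -> N) : Prop :=
  [/\ elementary j, saturated kappa N & strongly_homogeneous kappa N].

HB.mixin Record isTopologicalGroup G of Group G & Topological G := {
  mulg_continuous : continuous (fun x : G * G => (x.1 * x.2)%g);
  invg_continuous : continuous (fun x : G => (x^-1)%g) }.

#[short(type="topologicalGroupType")]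
HB.structure Definition TopologicalGroup :=
  {G of Group G & Topological G & isTopologicalGroup G}.

(* No definability assumption is made on the topology. *)
Record definable_group (L : language) (M : structure L) := DefinableGroup {
  dg_group :> topologicalGroupType;
  dg_dim : nat;
  dg_emb : dg_group -> ('I_dg_dim -> M);
  dg_emb_inj : injective dg_emb;
  dg_definable : definable (range dg_emb);
  dg_mul_definable : definable
    [set x | exists g h : dg_group,
       x = vapp (vapp (dg_emb g) (dg_emb h)) (dg_emb (g * h)%g)] }.

Definition mul_graph L (M : structure L) (G : definable_group M) :
    set ('I_(dg_dim G) + 'I_(dg_dim G) + 'I_(dg_dim G) -> M) :=
  [set x | exists g h : G,
     x = vapp (vapp (dg_emb g) (dg_emb h)) (dg_emb (g * h)%g)].

Record type_space L (M : structure L) (G : definable_group M) := TypeSpace {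
  ts_type :> set (formula L ('I_(dg_dim G) + M));
  ts_complete : complete_type ts_type;
  ts_concentrates :
    exists2 phi, ts_type phi & defines phi (range (@dg_emb _ _ G)) }.

Section TypeSpaceTopology.
Context (L : language) (M : structure L) (G : definable_group M).

Definition type_of_one : type_space G.
Proof.
exists [set phi | satp (idfun : M -> M) phi (dg_emb (1%g : G))].
- split; first by move=> F Fp _; exists (dg_emb (1%g : G)).
  by move=> phi; apply: EM.
- have [phi phiP] := dg_definable G; exists phi => //=.
  have : range (@dg_emb _ _ G) (dg_emb (1%g : G)) by exists 1%g.
  by rewrite {1}phiP.
Defined.

HB.instance Definition _ := gen_eqMixin (type_space G).
HB.instance Definition _ := gen_choiceMixin (type_space G).
HB.instance Definition _ := isPointed.Build (type_space G) type_of_one.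
HB.instance Definition _ := isSubBaseTopological.Build (type_space G)
  (range (fun phi => [set p : type_space G | ts_type p phi])) id.

End TypeSpaceTopology.

(* The interpretation [D^*] in [C] of a definable subset [D] of [M]; when [j]
   is elementary it does not depend on the formula defining [D]. *)
Definition star L (M C : structure L) (j : M -> C) (V : Type) (D : set (V -> M)) :
    set (V -> C) :=
  [set c | exists2 phi, defines phi D & satp j phi c].

Definition invariant L (M C : structure L) (j : M -> C) (V : Type)
    (H : set (V -> C)) : Prop :=
  forall s : C -> C, automorphism s -> (forall m, s (j m) = j m) ->
    (fun a : V -> C => s \o a) @` H = H.

Definition type_definable L (M C : structure L) (j : M -> C) (V : Type)
    (H : set (V -> C)) : Prop :=
  exists Phi : set (formula L (V + M)), H = realizes j Phi.

Section Components.
Context (L L' : language) (i : sublanguage L L') (M C : structure L')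
  (j : M -> C) (G : definable_group (reduct i M)) (kappa : Type).

Notation Cn := ('I_(dg_dim G) -> C).

Definition star_of (U : set G) : set Cn := star j ((@dg_emb _ _ G) @` U).

Definition Gstar : set Cn := star_of [set: G].

Definition constant (g : G) : Cn := j \o dg_emb g.

(* [star_mul a b c] says that a, b, c are in G^* and that c = a b. *)
Definition star_mul (a b c : Cn) : Prop :=
  star j (@mul_graph _ _ G) (vapp (vapp a b) c).

Definition setmul (A B : set Cn) : set Cn :=
  [set c | exists a b, [/\ A a, B b & star_mul a b c]].

Definition subgroup (H : set Cn) : Prop :=
  [/\ H `<=` Gstar, H (constant 1%g),
      forall a b c, H a -> H b -> star_mul a b c -> H c &
      forall a b, H a -> star_mul a b (constant 1%g) -> H b].

Definition normal (H : set Cn) : Prop :=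
  forall g h k c, Gstar g -> H h ->
    star_mul g h c -> star_mul k g c -> H k.

Definition bounded_index (H : set Cn) : Prop :=
  card_lt [set setmul [set a] H | a in Gstar] kappa.

Definition mu : set Cn := \bigcap_(U in [set U | open_nbhs (1%g : G) U]) star_of U.

(* [smallest P X] is the intersection of all the sets satisfying [P] that
   contain [X]. In a monster model, this intersection again has the property
   in the four cases below, i.e. it is the least such set. *)

Definition G00_M : set Cn :=
  smallest [set H | [/\ subgroup H, bounded_index H &
    @type_definable _ (reduct i M) (reduct i C) j _ H]] set0.

Definition G000_M : set Cn :=
  smallest [set H | [/\ subgroup H, bounded_index H &
    @invariant _ (reduct i M) (reduct i C) j _ H]] set0.

Definition G00_top : set Cn :=
  smallest [set H | [/\ subgroup H, bounded_index H &
    exists2 F : set (set G), F `<=` open & H = \bigcap_(U in F) star_of U]] set0.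

Definition G000_top : set Cn :=
  smallest [set H | [/\ subgroup H, normal H, bounded_index H &
    invariant j H]] mu.

Definition G00_def_top : set Cn := setmul G00_top G00_M.
Definition G000_def_top : set Cn := setmul G000_top G000_M.

End Components.

Section Amenability.
Context (L L' : language) (i : sublanguage L L') (M C : structure L')
  (j : M -> C) (G : definable_group (reduct i M)).

(* All realizations of [p] lie in [G^*], as [p] concentrates on [G]. *)
Definition realizations (p : type_space G) : set ('I_(dg_dim G) -> C) :=
  @realizes _ (reduct i C) _ j _ p.

Definition mu_rel (p q : type_space G) : bool :=
  `[< setmul j (mu j (G := G)) (realizations p) =
      setmul j (mu j (G := G)) (realizations q) >].

Lemma mu_rel_equiv : equiv_class_of mu_rel.
Proof.
split=> [p|p q|q p r]; rewrite /mu_rel.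
- exact/asboolP.
- by apply/asboolP/asboolP.
- by move=> /asboolP -> .
Qed.

Canonical mu_equiv := EquivRelPack mu_rel_equiv.

Definition mu_type_space := quotient_topology {eq_quot mu_equiv}.
HB.instance Definition _ := Pointed.on mu_type_space.
HB.instance Definition _ := Topological.on mu_type_space.

(* [q = g p], that is [p = tp(a/M)] and [q = tp(ga/M)] for some [a] *)
Definition type_translate (g : G) (p q : type_space G) : Prop :=
  exists a c, [/\ realizations p a, star_mul j (constant j g) a c &
                  realizations q c].

Definition translate (g : G) (B : set mu_type_space) : set mu_type_space :=
  [set y | exists p q, [/\ B (\pi_mu_type_space p), type_translate g p q &
                           y = \pi_mu_type_space q]].

Definition definably_topologically_amenable (R : realType) : Prop :=
  exists nu : probability (g_sigma_algebraType (@open mu_type_space)) R,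
    forall (g : G) (B : set mu_type_space),
      (@open mu_type_space).-sigma.-measurable B -> nu (translate g B) = nu B.

End Amenability.

(* Main.v *)
(* The inclusion from right to left is soft. For the other one we exhibit a subgroup
   [K0] of [G^*] which is both an intersection of sets [U^*], [U] open, and
   type-definable over [M] in [L], and which lies in [G000_top * G000_M].

   For a definable open subgroup [H] and a finite family [F] of definable sets let
   [X_F] be the set of the [x] such that some [a] and [a x] belong to the same sets
   of [F], and let [A = H X_F H]. As [F] grows, [X_F^*] shrinks to the set of the
   products [a^-1 b] with [a], [b] of the same type over [M], and as [H] shrinks,
   [H^*] shrinks to [mu]. Put [K0 = /\ (A^4)^*]. By compactness every element of
   [K0] is a product of elements of [mu] and of elements [a^-1 b] as above; the
   latter lie in every [M]-invariant subgroup of bounded index. [K0] is a group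
   provided that for each [A] there is [A'] of the same kind with [A'^8] inside
   [A^4], and this is where amenability enters, through the argument of Massicot and
   Wagner. The invariant measure gives a finitely additive left-invariant measure [m]
   on the definable sets which are left-invariant under some definable open subgroup.
   Choosing [B] inside [A] such that [m (B A)] is almost minimal among large sets
   [B], the elements [g] such that [g B] meets [B] in a large set almost fix [B A],
   so products of 16 of them or of their inverses lie in [A A A^-1 A^-1].
   To keep the set [S] of these elements definable in [L], "large" is not
   expressed with [m]: a set [B] is [d + 1]-large when boundedly many translates of
   [{g | g B /\ B is d-large}] cover [G]. Finally, since [G] is covered by finitely
   many translates [g_i S] and [S] is right-invariant under an open subgroup [H'],
   the set [S^-1 S] contains [A'] for [H'] and the family of the [g_i S]. *)

From HB Require Import structures.
Require Import Defs.
From mathcomp Require Import all_boot all_order all_algebra.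
From mathcomp Require Import all_classical all_reals all_analysis.
From mathcomp Require Import lra.

Set Implicit Arguments.
Unset Strict Implicit.
Unset Printing Implicit Defensive.

Import Order.TTheory GRing.Theory Num.Theory.
Local Open Scope classical_set_scope.

(** * Formulas *)

Definition Conj L (V : Type) (phi psi : formula L V) : formula L V :=
  Neg (Imp phi (Neg psi)).
Definition Ex L (V : Type) (phi : formula L (option V)) : formula L V :=
  Neg (All (Neg phi)).

Fixpoint trename L (V W : Type) (f : V -> W) (t : term L V) : term L W :=
  match t with
  | Var v => Var L (f v)
  | App _ g ts => App g (fun k => trename f (ts k))
  end.

Fixpoint rename L (V W : Type) (f : V -> W) (phi : formula L V) : formula L W :=
  match phi with
  | Equal s t => Equal (trename f s) (trename f t)
  | Rel _ r ts => Rel r (fun k => trename f (ts k))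
  | Bot => Bot
  | Imp psi chi => Imp (rename f psi) (rename f chi)
  | All psi => All (rename (omap f) psi)
  end.

Section FormulaSemantics.
Context (L : language) (M : structure L).

Lemma eval_rename (V W : Type) (f : V -> W) (t : term L V) (x : W -> M) :
  Defs.eval x (trename f t) = Defs.eval (x \o f) t.
Proof.
elim: t => [v//|n g ts IH] /=.
by congr (fun_interp _ _); apply: funext => k; apply: IH.
Qed.

Lemma sat_rename (V W : Type) (f : V -> W) (phi : formula L V) (x : W -> M) :
  sat (rename f phi) x <-> sat phi (x \o f).
Proof.
elim: phi W f x => {V} [V s t|V n r ts|V|V p IHp q IHq|V p IH] W f x /=.
- by rewrite !eval_rename.
- by under [X in rel_interp r X]eq_fun do rewrite eval_rename.
- by [].
- by split=> h /IHp/h/IHq.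
- split=> h d; move: (h d).
  + by move=> /IH; congr (sat p _); apply: funext => -[].
  + by move=> hd; apply/IH; move: hd; congr (sat p _); apply: funext => -[].
Qed.

Lemma sat_Neg (V : Type) (phi : formula L V) (x : V -> M) :
  sat (Neg phi) x <-> ~ sat phi x.
Proof. by []. Qed.

Lemma sat_Conj (V : Type) (phi psi : formula L V) (x : V -> M) :
  sat (Conj phi psi) x <-> sat phi x /\ sat psi x.
Proof.
by split=> [h|[p q] /= h]; [split; apply: contrapT => n; apply: h|exact: h].
Qed.

Lemma sat_Ex (V : Type) (phi : formula L (option V)) (x : V -> M) :
  sat (Ex phi) x <-> exists d, sat phi (fun v => oapp x d v).
Proof.
split=> [h|[d hd] /= h]; last exact: (h d).
by apply: contrapT => n; apply: h => d hd; apply: n; exists d.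
Qed.

End FormulaSemantics.

(** Coordinate [ord0] becomes the bound variable [None] of [Ex], so that [ExTuple] can quantify a
    block of variables one at a time. *)
Definition split_tuple n (V : Type) (v : 'I_n.+1 + V) : 'I_n + option V :=
  match v with
  | inl i => if unlift ord0 i is Some k then inl k else inr None
  | inr w => inr (Some w)
  end.

Definition ord0_elim (T : Type) (i : 'I_0) : T := False_rect T (notF (ltn_ord i)).

Fixpoint ExTuple L n (V : Type) : formula L ('I_n + V) -> formula L V :=
  match n return formula L ('I_n + V) -> formula L V with
  | 0 => rename (fun v => match v with
                          | inl i => ord0_elim V i
                          | inr w => w end)
  | n'.+1 => fun phi => Ex (ExTuple (rename (@split_tuple n' V) phi))
  end.

Lemma sat_ExTuple L (M : structure L) n (V : Type) (phi : formula L ('I_n + V))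
    (x : V -> M) :
  sat (ExTuple phi) x <-> exists y : 'I_n -> M, sat phi (vapp y x).
Proof.
elim: n V phi x => [|n IH] V phi x.
  rewrite /= sat_rename; split=> [h|[y]].
    exists (ord0_elim M).
    by move: h; congr (sat phi _); apply: funext => -[[]|].
  by congr (sat phi _); apply: funext => -[[]|].
rewrite [ExTuple phi]/= sat_Ex; split=> [[d /IH[y]]|[y hy]].
  move=> /sat_rename h.
  exists (fun i => if unlift ord0 i is Some k then y k else d).
  move: h; congr (sat phi _); apply: funext => -[i|w] //=.
  by case: (unlift ord0 i).
exists (y ord0); apply/IH; exists (y \o lift ord0); apply/sat_rename.
move: hy; congr (sat phi _); apply: funext => -[i|w] //=.
by case: unliftP => [k ->|->].
Qed.

Lemma satpE L (M : structure L) (A V : Type) (a : A -> M)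
    (phi : formula L (V + A)) x : satp a phi x = sat phi (vapp x a).
Proof. by []. Qed.

(** * Formulas of the smaller language read in the larger one *)

Section Lift.
Context (L L' : language) (i : sublanguage L L').

Fixpoint tlift (V : Type) (t : term L V) : term L' V :=
  match t with
  | Var v => Var L' v
  | App _ g ts => App (incl_fun i g) (fun k => tlift (ts k))
  end.

Fixpoint lift_formula (V : Type) (phi : formula L V) : formula L' V :=
  match phi with
  | Equal s t => Equal (tlift s) (tlift t)
  | Rel _ r ts => Rel (incl_rel i r) (fun k => tlift (ts k))
  | Bot => Bot
  | Imp psi chi => Imp (lift_formula psi) (lift_formula chi)
  | All psi => All (lift_formula psi)
  end.

Lemma eval_lift (N : structure L') (V : Type) (t : term L V) (x : V -> N) :
  Defs.eval x (tlift t) = Defs.eval (x : V -> reduct i N) t.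
Proof.
elim: t => [v//|n g ts IH] /=.
by congr (fun_interp _ _); apply: funext => k; apply: IH.
Qed.

Lemma sat_lift (N : structure L') (V : Type) (phi : formula L V) (x : V -> N) :
  sat (lift_formula phi) x <-> sat phi (x : V -> reduct i N).
Proof.
elim: phi x => {V} [V s t|V n r ts|V|V p IHp q IHq|V p IH] x /=.
- by rewrite !eval_lift.
- by under [X in rel_interp _ X]eq_fun do rewrite eval_lift.
- by [].
- by split=> h /IHp/h/IHq.
- by split=> h d; apply/IH/h.
Qed.

End Lift.

(** * First-order formulas on a group *)

(* First-order formulas on a group, in a relational signature: [GIn A i] is
   membership in the set coded by [A] and [GMul a b c] the relation [a b = c].
   They are interpreted both in G and in its extension K. *)
Inductive gform (P G I : Type) : Type :=
| GTrue
| GIn of P & I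
| GMul of I & I & I
| GEq of I & I
| GNot of gform P G I
| GAnd of gform P G I & gform P G I
| GOr of gform P G I & gform P G I
| GImp of gform P G I & gform P G I
| GEx of gform P G (option I)
| GAll of gform P G (option I)
| GSub (J : Type) of (J -> I + G) & gform P G J.
Arguments GTrue {P G I}.
Arguments GIn {P G I}.
Arguments GMul {P G I}.
Arguments GEq {P G I}.
Arguments GSub {P G I J}.

(** Under [GSub], a variable is read either as a variable of the context or as an element of G sent
    into the domain by [c]. This is how elements of G enter formulas as parameters. *)
Definition sum_case (I G D : Type) (x : I -> D) (c : G -> D) (v : I + G) : D :=
  match v with inl i => x i | inr g => c g end.

Fixpoint gsat (P G D : Type) (pr : P -> set D) (mul : D -> D -> D -> Prop)
    (c : G -> D) (I : Type) (phi : gform P G I) : (I -> D) -> Prop :=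
  match phi with
  | GTrue => fun _ => True
  | GIn A i => fun x => pr A (x i)
  | GMul i j k => fun x => mul (x i) (x j) (x k)
  | GEq i j => fun x => x i = x j
  | GNot p => fun x => ~ gsat pr mul c p x
  | GAnd p q => fun x => gsat pr mul c p x /\ gsat pr mul c q x
  | GOr p q => fun x => gsat pr mul c p x \/ gsat pr mul c q x
  | GImp p q => fun x => gsat pr mul c p x -> gsat pr mul c q x
  | GEx p => fun x => exists d, gsat pr mul c p (fun v => oapp x d v)
  | GAll p => fun x => forall d, gsat pr mul c p (fun v => oapp x d v)
  | GSub J f p => fun x => gsat pr mul c p (fun v => sum_case x c (f v))
  end.

(** * Translation of group formulas into formulas of the ambient structure *)

Section Translation.
Context (L : language) (M : structure L) (G : Type) (n : nat) (emb : G -> 'I_n -> M).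
Context (pin : formula L ('I_n + M)) (pmul : formula L ('I_n + 'I_n + 'I_n + M)).
Notation P := (formula L ('I_n + M)).

Definition var_at (I : Type) (i : I) (v : 'I_n + M) : I * 'I_n + M :=
  match v with inl k => inl (i, k) | inr m => inr m end.

Definition var_at3 (I : Type) (a b c : I) (v : 'I_n + 'I_n + 'I_n + M) :
    I * 'I_n + M :=
  match v with
  | inl (inl (inl k)) => inl (a, k)
  | inl (inl (inr k)) => inl (b, k)
  | inl (inr k) => inl (c, k)
  | inr m => inr m
  end.

Definition var_sub (I J : Type) (f : J -> I + G) (v : J * 'I_n + M) : I * 'I_n + M :=
  match v with
  | inl (j, k) => match f j with inl i => inl (i, k) | inr g => inr (emb g k) end
  | inr m => inr m
  end.

Definition var_open (I : Type) (v : option I * 'I_n + M) : 'I_n + (I * 'I_n + M) :=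
  match v with
  | inl (None, k) => inl k
  | inl (Some i, k) => inr (inl (i, k))
  | inr m => inr (inr m)
  end.

Definition var_new (I : Type) (v : 'I_n + M) : 'I_n + (I * 'I_n + M) :=
  match v with inl k => inl k | inr m => inr (inr m) end.

Definition ex_in (I : Type) (phi : formula L (option I * 'I_n + M)) :
    formula L (I * 'I_n + M) :=
  ExTuple (Conj (rename (@var_new I) pin) (rename (@var_open I) phi)).

Definition eq_at (I : Type) (a b : I) : formula L (I * 'I_n + M) :=
  foldr (fun k => Conj (Equal (Var L (inl (a, k))) (Var L (inl (b, k))))) (Neg Bot) (enum 'I_n).

(** A group variable [i] becomes the block of variables [(i, k)], [k] in ['I_n]. Quantifiers over
    the group are relativised to the tuples satisfying [pin], the universal one through its
    negation. *)
Fixpoint gtr (I : Type) (phi : gform P G I) : formula L (I * 'I_n + M) :=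
  match phi with
  | GTrue => Neg Bot
  | GIn A i => rename (var_at i) A
  | GMul a b c => rename (var_at3 a b c) pmul
  | GEq a b => eq_at a b
  | GNot p => Neg (gtr p)
  | GAnd p q => Conj (gtr p) (gtr q)
  | GOr p q => Neg (Conj (Neg (gtr p)) (Neg (gtr q)))
  | GImp p q => Imp (gtr p) (gtr q)
  | GEx p => ex_in (gtr p)
  | GAll p => Neg (ex_in (Neg (gtr p)))
  | GSub _ f p => rename (var_sub f) (gtr p)
  end.

Context (N : structure L) (h : M -> N) (D : Type) (e : D -> 'I_n -> N).
Context (mul : D -> D -> D -> Prop) (c : G -> D).
Hypothesis pinP : forall x, satp h pin x <-> range e x.
Hypothesis pmulP : forall a b d,
  satp h pmul (vapp (vapp (e a) (e b)) (e d)) <-> mul a b d.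
Hypothesis e_inj : injective e.
Hypothesis cP : forall g, e (c g) = h \o emb g.

Definition pr_of (A : P) : set D := [set d | satp h A (e d)].

Definition flat (I : Type) (x : I -> D) : I * 'I_n -> N := fun v => e (x v.1) v.2.

Lemma sat_ex_in (I : Type) (phi : formula L (option I * 'I_n + M)) (x : I -> D) :
  satp h (ex_in phi) (flat x) <->
  exists d, satp h phi (flat (fun v => oapp x d v)).
Proof.
rewrite /ex_in satpE sat_ExTuple; split=> [[y]|[d hd]].
  rewrite sat_Conj => -[/sat_rename hy /sat_rename hp].
  have [d _ dy] : range e y.
    by apply/pinP; move: hy; congr (sat pin _); apply: funext => -[].
  exists d; rewrite satpE; move: hp; congr (sat phi _).
  by rewrite -dy; apply: funext => -[[[i|] k]|m].
exists (e d); rewrite sat_Conj !sat_rename; split.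
  have : satp h pin (e d) by apply/pinP; exists d.
  by rewrite satpE; congr (sat pin _); apply: funext => -[].
by move: hd; rewrite satpE; congr (sat phi _); apply: funext => -[[[i|] k]|m].
Qed.

Lemma sat_eq_at (I : Type) (a b : I) (x : I -> D) :
  satp h (eq_at a b) (flat x) <-> x a = x b.
Proof.
have -> : x a = x b <-> forall k, k \in enum 'I_n -> e (x a) k = e (x b) k.
  split=> [->//|k]; apply: e_inj; apply: funext => i; apply: k.
  by rewrite mem_enum.
rewrite /eq_at satpE; elim: (enum _) => [|k s IH]; first by split=> // _ [].
rewrite [foldr _ _ _]/= sat_Conj IH /=; split=> [[E h' i]|h'].
  by rewrite inE => /predU1P[->|/h'].
split=> [|i si]; apply: h'; rewrite inE ?eqxx// si orbT //.
Qed.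

Lemma sat_gtr (I : Type) (phi : gform P G I) (x : I -> D) :
  satp h (gtr phi) (flat x) <-> gsat pr_of mul c phi x.
Proof.
elim: phi x => {I} [I|I A i|I a b d|I a b|I p IH|I p IHp q IHq|I p IHp q IHq|I p IHp q IHq
  |I p IH|I p IH|I J f p IH] x; rewrite [gtr _]/= [gsat _ _ _ _ _]/= ?satpE.
- by split=> // _ [].
- rewrite sat_rename /pr_of /= satpE.
  by have -> : vapp (flat x) h \o var_at i = vapp (e (x i)) h
    by apply: funext => -[].
- rewrite sat_rename -pmulP satpE.
  by have -> // : vapp (flat x) h \o var_at3 a b d =
    vapp (vapp (vapp (e (x a)) (e (x b))) (e (x d))) h
    by apply: funext => -[[[]|]|].
- exact: sat_eq_at.
- by rewrite sat_Neg -IH.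
- by rewrite sat_Conj -IHp -IHq.
- rewrite sat_Neg sat_Conj !sat_Neg -IHp -IHq !satpE.
  by split=> [k|[] k [] //]; apply: contrapT => /not_orP.
- by rewrite -IHp -IHq.
- by rewrite -satpE sat_ex_in; split=> -[d /IH]; exists d.
- rewrite sat_Neg -satpE sat_ex_in; split=> [k d|k [d]].
    by apply/IH; apply: contrapT => kd; apply: k; exists d.
  by rewrite satpE sat_Neg; apply; apply/IH.
- rewrite sat_rename -IH satpE.
  have -> // : vapp (flat x) h \o var_sub f =
               vapp (flat (fun v => sum_case x c (f v))) h.
  apply: funext => -[[j k]|m] //=.
  by rewrite /flat /=; case: (f j) => //= g; rewrite cP.
Qed.

End Translation.

(** The data needed to transfer statements from G to K, for L as well as for L'. The products are
    relations, so that the record can be formed for [G^*] before it is known to be a group. *)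
Record extension (L : language) (M C : structure L) (j : M -> C) (G K : Type)
    (n : nat) (emb : G -> 'I_n -> M) (val : K -> 'I_n -> C)
    (mulG : G -> G -> G -> Prop) (mulK : K -> K -> K -> Prop) (c : G -> K) := Extension {
  ext_elem : elementary j;
  ext_emb_inj : injective emb;
  ext_val_inj : injective val;
  ext_cst : forall g, val (c g) = j \o emb g;
  ext_in : formula L ('I_n + M);
  ext_inG : forall x, satp (idfun : M -> M) ext_in x <-> range emb x;
  ext_inK : forall x, satp j ext_in x <-> range val x;
  ext_mul : formula L ('I_n + 'I_n + 'I_n + M);
  ext_mulG : forall a b d,
    satp (idfun : M -> M) ext_mul (vapp (vapp (emb a) (emb b)) (emb d)) <-> mulG a b d;
  ext_mulK : forall a b d,
    satp j ext_mul (vapp (vapp (val a) (val b)) (val d)) <-> mulK a b d }.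

Section Transfer.
Context (L : language) (M C : structure L) (j : M -> C) (G K : Type).
Context (n : nat) (emb : G -> 'I_n -> M) (val : K -> 'I_n -> C).
Context (mulG : G -> G -> G -> Prop) (mulK : K -> K -> K -> Prop) (c : G -> K).
Context (E : extension j emb val mulG mulK c).

Definition ext_gtr (I : Type) (phi : gform (formula L ('I_n + M)) G I) :=
  gtr emb (ext_in E) (ext_mul E) phi.

Definition gsatG := gsat (pr_of idfun emb) mulG id.
Definition gsatK := gsat (pr_of j val) mulK c.

Lemma sat_gtrG (I : Type) (phi : gform (formula L ('I_n + M)) G I) (x : I -> G) :
  satp (idfun : M -> M) (ext_gtr phi) (flat emb x) <-> gsatG phi x.
Proof. by apply: sat_gtr => //; [exact: (ext_inG E)|exact: (ext_mulG E)|exact: (ext_emb_inj E)]. Qed.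

Lemma sat_gtrK (I : Type) (phi : gform (formula L ('I_n + M)) G I) (x : I -> K) :
  satp j (ext_gtr phi) (flat val x) <-> gsatK phi x.
Proof. by apply: sat_gtr; [exact: (ext_inK E)|exact: (ext_mulK E)|exact: (ext_val_inj E)|exact: (ext_cst E)].
Qed.

Lemma elem_satp (V : Type) (phi : formula L (V + M)) (x : V -> M) :
  satp (idfun : M -> M) phi x <-> satp j phi (j \o x).
Proof.
rewrite !satpE (ext_elem E).
by have -> : j \o vapp x idfun = vapp (j \o x) j by apply: funext => -[].
Qed.

(** Elementarity of [j] applied to the translated formula. Through this lemma first-order facts
    about G become facts about K. *)
Lemma gsat_transfer (I : Type) (phi : gform (formula L ('I_n + M)) G I) (x : I -> G) :
  gsatG phi x <-> gsatK phi (c \o x).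
Proof.
rewrite -sat_gtrG -sat_gtrK elem_satp.
have -> // : flat val (c \o x) = j \o flat emb x.
by apply: funext => -[i k]; rewrite /flat /= (ext_cst E).
Qed.

End Transfer.

(** * Monster models and coheirs *)

Local Open Scope card_scope.

Lemma card_lt_le (S T kappa : Type) (A : set S) (B : set T) :
  A #<= B -> card_lt B kappa -> card_lt A kappa.
Proof.
move=> AB [Bk kB]; split; first exact: card_le_trans AB Bk.
by move=> kA; apply: kB; apply: card_le_trans kA AB.
Qed.

Section Monster.
Context (kappa : Type) (L : language) (C : structure L).

(** Strong homogeneity speaks of subsets of C; later uses need families indexed by a small type,
    possibly with repetitions. *)
Lemma homogeneous_map : strongly_homogeneous kappa C ->
  forall (V : Type) (x y : V -> C), card_lt [set: V] kappa ->
  (forall phi : formula L V, sat phi x <-> sat phi y) ->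
  exists2 s : C -> C, automorphism s & forall v, s (x v) = y v.
Proof.
move=> hom V x y sV xy; pose A := range x.
have /choice[r rP] : forall a : set_type A, exists v, x v = set_val a.
  by move=> a; have /set_mem[v _ vE] := valP a; exists v.
have [||s s_aut sr] := hom A _ (y \o r).
- exact: card_lt_le (card_image_le _ _) sV.
- move=> phi; have -> : set_val = x \o r by apply: funext => a /=; rewrite rP.
  by split=> /sat_rename/xy/sat_rename.
exists s => // v; have Av : x v \in A by apply/mem_set; exists v.
rewrite -[x v]/(set_val (SigSub Av)) sr /=.
(* Repetitions in [x] are repetitions in [y], because equality of two variables is a formula. *)
have /(xy (Equal (Var L _) (Var L v))) := rP (SigSub Av).
by [].
Qed.

Lemma saturated_realizes : saturated kappa C ->
  forall n (V : Type) (x : V -> C) (p : set (formula L ('I_n + V))),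
  card_lt [set: V] kappa -> finitely_satisfiable x p -> realizes x p !=set0.
Proof.
move=> satC n V x p sV fin; pose A := range x.
have xA v : x v \in A by apply/mem_set; exists v.
pose e (w : 'I_n + V) : 'I_n + set_type A :=
  match w with inl i => inl i | inr v => inr (SigSub (xA v)) end.
have satE phi c : satp (@set_val _ A) (rename e phi) c <-> satp x phi c.
  rewrite !satpE sat_rename.
  by have -> : vapp c set_val \o e = vapp c x by apply: funext => -[].
have [||c cP] := satC A _ n (rename e @` p).
- exact: card_lt_le (card_image_le _ _) sV.
- move=> F Fp Ffin.
  have /choice[h hP] : forall psi, exists phi, F psi -> p phi /\ rename e phi = psi.
    move=> psi; have [/Fp[phi pphi <-]|nF] := pselect (F psi); first by exists phi.
    by exists Bot.
  have [||c cP] := fin (h @` F).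
  + by move=> _ [psi Fpsi <-]; have [] := hP _ Fpsi.
  + exact: finite_image.
  exists c => psi Fpsi; have [_ <-] := hP _ Fpsi.
  by apply/satE/cP; exists psi.
by exists c => phi pphi; apply/satE/cP; exists phi.
Qed.

Lemma automorphism_sat (s : C -> C) : automorphism s ->
  forall (V : Type) (phi : formula L V) (x : V -> C), sat phi x <-> sat phi (s \o x).
Proof.
move=> [[t ts st] sfun srel] V phi.
have ev (W : Type) (u : term L W) (x : W -> C) :
    s (Defs.eval x u) = Defs.eval (s \o x) u.
  elim: u => [//|m f us IH] /=; rewrite sfun; congr (fun_interp _ _).
  by apply: funext => k; apply: IH.
elim: phi => {V} [V u v|V m r us|V|V p IHp q IHq|V p IH] x /=.
- rewrite -!ev; split=> [->//|/(congr1 t)]; by rewrite !ts.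
- rewrite srel; split; congr (rel_interp r _);
  by apply: funext => k /=; rewrite ev.
- by [].
- by split=> h hp; apply/(IHq x)/h/(IHp x).
- have E d : (fun v => oapp (s \o x) (s d) v) = s \o (fun v => oapp x d v).
    by apply: funext => -[].
  split=> h d; last by apply/IH; rewrite -E; apply: h.
  have -> : d = s (t d) by rewrite st.
  by rewrite E; apply: (IH _).1; apply: h.
Qed.

End Monster.

(** A formula over M true of [a] has a solution in M by elementarity, so the traces on M of these
    formulas generate a proper filter. An ultrafilter containing it describes a coheir of the type
    of [a]. *)
Lemma coheir_filter L (M C : structure L) (j : M -> C) n (a : 'I_n -> C) :
  elementary j ->
  exists U : set_system ('I_n -> M), UltraFilter U /\
    forall phi : formula L ('I_n + M), satp j phi a ->
      U [set m | satp (idfun : M -> M) phi m].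
Proof.
move=> ej.
pose B := [set D | exists2 phi : formula L ('I_n + M), satp j phi a &
                    [set m | satp (idfun : M -> M) phi m] `<=` D].
suff BP : ProperFilter B.
  have [U [UU BU]] := ultraFilterLemma BP; exists U; split=> // phi pa.
  by apply: BU; exists phi.
apply: Build_ProperFilter_ex => [D [phi pa /= sD]|].
  have /ej/sat_ExTuple[m hm] : sat (ExTuple phi) (j \o idfun).
    by apply/sat_ExTuple; exists a.
  by exists m; apply: sD.
split; first by exists (Neg Bot) => // [[]].
- move=> D D' [phi pa sD] [psi qa sD']; exists (Conj phi psi).
    by rewrite satpE sat_Conj.
  by move=> m /=; rewrite satpE sat_Conj => -[? ?]; split; [apply: sD|apply: sD'].
- by move=> D D' DD' [phi pa sD]; exists phi => // m /sD/DD'.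
Qed.

Lemma ultraC T (U : set_system T) (A : set T) : UltraFilter U -> ~ U A <-> U (~` A).
Proof.
move=> UU; split=> [nA|UnA UA]; first by have [] := in_ultra_setVsetC A UU.
by have [x []] := filter_ex (filterI UA UnA).
Qed.

Lemma finite_filterI T (I : Type) (U : set_system T) (F : set I) (D : I -> set T) :
  Filter U -> finite_set F -> (forall i, F i -> U (D i)) ->
  U [set t | forall i, F i -> D i t].
Proof.
move=> UF Ffin h.
(* [{classic I}] supplies the decidable equality needed to enumerate [F] as a sequence. *)
pose F' : set {classic I} := F.
have [s sE] := (@finite_seqP {classic I} F').1 Ffin.
have -> : [set t | forall i, F i -> D i t] = [set t | forall i, i \in s -> D i t].
  have sP i : F i <-> (i \in s) by change (F' i <-> (i \in s)); rewrite sE.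
  by apply/seteqP; split=> t /= k i /sP; apply: k.
have {}h : forall i, i \in s -> U (D i).
  by move=> i si; apply: h; change (F' i); rewrite sE.
elim: s h {sE} => [|i s IH] h; first by apply: filterS filterT => t _ i.
have h1 : U [set t | forall k, k \in s -> D k t].
  by apply: IH => k ks; apply: h; rewrite inE ks orbT.
have h2 : U (D i) by apply: h; rewrite inE eqxx.
apply: filterS (filterI h1 h2) => t [k1 k2] k.
by rewrite inE => /orP[/eqP->|/k1].
Qed.

Section Coheir.
Context (kappa : Type) (L : language) (M C : structure L) (j : M -> C) (n : nat).
Hypothesis satC : saturated kappa C.

(** The formulas over [x] which hold for [U]-almost all tuples of M are finitely satisfied by tuples
    of M, so saturation realises them. As [U] is an ultrafilter, they form a complete type, whence
    the equivalence. *)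
Lemma coheir_realizes (U : set_system ('I_n -> M)) (V : Type) (x : V -> C) :
  UltraFilter U -> card_lt [set: V] kappa ->
  exists c : 'I_n -> C, forall phi : formula L ('I_n + V),
    sat phi (vapp c x) <-> U [set m | sat phi (vapp (j \o m) x)].
Proof.
move=> UU sV.
pose p := [set phi : formula L ('I_n + V) | U [set m | sat phi (vapp (j \o m) x)]].
have fin : finitely_satisfiable x p.
  move=> F Fp Ffin.
  have [m hm] := filter_ex (finite_filterI _ Ffin Fp).
  by exists (j \o m).
have [c cP] := saturated_realizes satC sV fin.
exists c => phi; split=> [h|]; last exact: cP.
apply: contrapT => /(ultraC _ UU) h'.
exact: (cP (Neg phi) h' h).
Qed.

End Coheir.

(** * Small cardinals and bounded invariant equivalence relations *)

Local Open Scope card_scope.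

Lemma cardT_leP (S T : Type) :
  ([set: S] #<= [set: T]) <-> exists f : S -> T, injective f.
Proof.
split=> [/card_leP[f]|[f finj]]; last first.
  have /injfunPex[g] : exists2 g : S -> T, set_fun setT setT g & set_inj setT g.
    by exists f => // x y _ _ /finj.
  exact: inj_card_le g.
exists (fun s => set_val (f (SigSub (in_setT s)))) => x y /val_inj h.
have : SigSub (in_setT x) = SigSub (in_setT y) by apply: ('inj_f); rewrite ?inE.
by move=> /(congr1 val).
Qed.

Lemma card_le_inj (S T : Type) (A : set S) (f : S -> T) :
  {in A &, injective f} -> A #<= [set: T].
Proof.
move=> finj; have /injfunPex[g] : exists2 g : S -> T, set_fun A setT g & set_inj A g.
  by exists f.
exact: inj_card_le g.
Qed.

(** Zorn's lemma gives a maximal partial injection. It is total or onto, since otherwise a missed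
    pair could be added. *)
Lemma injection_total (S T : Type) :
  (exists f : S -> T, injective f) \/ (exists f : T -> S, injective f).
Proof.
pose P (R : set (S * T)) := forall p q, R p -> R q -> p.1 = q.1 <-> p.2 = q.2.
have [|R [PR Rmax]] := @Zorn_bigcup _ P.
  move=> F FP Ftot p q [X FX Xp] [Y FY Yq].
  by have [XY|YX] := Ftot _ _ FX FY; [apply: (FP Y)|apply: (FP X)] => //;
     [apply: XY|apply: YX].
have [/choice[f fP]|/existsNP[s sR]] := pselect (forall s, exists t, R (s, t)).
  left; exists f => x y fxy.
  by have /= [_ ->] := PR _ _ (fP x) (fP y).
have [/choice[f fP]|/existsNP[t tR]] := pselect (forall t, exists s, R (s, t)).
  right; exists f => x y fxy.
  by have /= [-> ] := PR _ _ (fP x) (fP y).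
exfalso; apply: (Rmax (R `|` [set (s, t)])).
  split=> [p|]; first by left.
  by move=> /(_ (s, t)) h; apply: sR; exists t; apply: h; right.
move=> p q [Rp|->] [Rq|->] //=; first exact: PR.
- split=> h; exfalso; first by apply: sR; exists p.2; rewrite -h -surjective_pairing.
  by apply: tR; exists p.1; rewrite -h -surjective_pairing.
- split=> h; exfalso; first by apply: sR; exists q.2; rewrite h -surjective_pairing.
  by apply: tR; exists q.1; rewrite h -surjective_pairing.
Qed.

Section SmallTypes.
Context (kappa : Type).
Hypothesis kappaP : strong_limit kappa.
Notation small T := (card_lt [set: T] kappa).

Lemma small_inj (S T : Type) (f : S -> T) : injective f -> small T -> small S.
Proof. by move=> finj; apply: card_lt_le; apply/cardT_leP; exists f. Qed.

Lemma small_set (T : Type) : small T -> small (set T).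
Proof.
move=> sT; have /cardT_leP[f finj] := sT.1.
have sr : card_lt (range f) kappa by exact: card_lt_le (card_image_le _ _) sT.
have := kappaP.2 _ sr.
apply: card_lt_le; apply/card_le_trans; last exact: subset_card_le (@subset_refl _ _).
have /injfunPex[g] : exists2 g : set T -> set kappa,
    set_fun setT [set B | B `<=` range f] g & set_inj setT g.
  exists (fun A => f @` A) => [A _ _ [x _ <-]|A B _ _ AB]; first by exists x.
  apply/seteqP; split=> x Ax.
    have : (f @` A) (f x) by exists x.
    by rewrite AB => -[y By /finj <-].
  have : (f @` B) (f x) by exists x.
  by rewrite -AB => -[y By /finj <-].
exact: inj_card_le g.
Qed.

(** One summand injects into the other, say by [f]. Then [inl s] is coded by the family {{f s}} and
    [inr t] by {{t}, {}}, which never coincide, and the double power set of a small type is small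
    for a strong limit. *)
Lemma small_sum (A B : Type) : small A -> small B -> small (A + B)%type.
Proof.
suff sum_le (S T : Type) (f : S -> T) : injective f -> small T -> small (S + T)%type.
  move=> sA sB; have [[f fi]|[f fi]] := injection_total A B.
    exact: sum_le fi sB.
  apply: (@small_inj _ (B + A)%type (fun v => match v with inl a => inr a | inr b => inl b end)).
    by move=> [x|x] [y|y] // [->].
  exact: sum_le fi sA.
move=> fi sT; apply: (small_inj (f := fun v : S + T => match v with
  | inl s => [set [set f s]] | inr t => [set [set t]; set0] end))
  (small_set (small_set sT)).
have ne (x : T) : [set x] <> set0 by move=> /seteqP[/(_ x)] h _; exact: h.
have one (x y : T) : [set x] = [set y] -> x = y.
  by move=> /seteqP[/(_ x)] h _; exact: h.
have mem0 (t : T) : [set [set t]; set0] set0 by right.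
have mem1 (t : T) : [set [set t]; set0] [set t] by left.
move=> [x|x] [y|y] h.
- congr inl; apply: fi; apply: one.
  by have : [set [set f x]] [set f x] by []; rewrite h.
- by have := mem0 y; rewrite -h => /esym/ne.
- by have := mem0 x; rewrite h => /esym/ne.
- congr inr; have := mem1 x; rewrite h => -[/one//|/ne//].
Qed.

Lemma small_prod (A B : Type) : small A -> small B -> small (A * B)%type.
Proof.
move=> sA sB; apply: (small_inj (f := fun p => [set inl p.1; inr p.2]))
  (small_set (small_sum sA sB)).
move=> [a b] [a' b'] /= h.
have : [set inl a; inr b] (inl a : A + B) by left.
have : [set inl a; inr b] (inr b : A + B) by right.
by rewrite h => -[//|[->]] [[->]|].
Qed.

Lemma small_fun (A B : Type) : small A -> small B -> small (A -> B).
Proof.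
move=> sA sB; apply: (small_inj (f := fun f => [set (a, f a) | a in setT]))
  (small_set (small_prod sA sB)).
move=> f g h; apply: funext => a.
have : [set (a, f a) | a in setT] (a, f a) by exists a.
by rewrite h => -[a' _ [-> ->]].
Qed.

Lemma small_ord n : small 'I_n.
Proof. by apply: small_inj kappaP.1; exact: val_inj. Qed.

Lemma small_set_type (T : Type) (A : set T) : card_lt A kappa -> small (set_type A).
Proof.
apply: card_lt_le; apply: (proj1 (proj1 (card_eqPle _ _) _)).
exact: card_setT.
Qed.

End SmallTypes.

(** * Elements of the same type are equivalent for every bounded invariant relation *)

Section BoundedInvariant.
Context (kappa : Type) (L : language) (M C : structure L) (j : M -> C) (n : nat).
Hypothesis kappaP : strong_limit kappa.
Hypothesis smallM : card_lt [set: M] kappa.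
Hypothesis monC : monster kappa j.
Notation Cn := ('I_n -> C).
Notation small T := (card_lt [set: T] kappa).

Definition coheir (U : set_system ('I_n -> M)) (V : Type) (x : V -> C) (c : Cn) :=
  forall phi : formula L ('I_n + V),
    sat phi (vapp c x) <-> U [set m | sat phi (vapp (j \o m) x)].

Definition same_type (a b : Cn) :=
  forall phi : formula L ('I_n + M), satp j phi a <-> satp j phi b.

Definition fixing (s : C -> C) := automorphism s /\ forall m, s (j m) = j m.

Lemma elementaryP : elementary j. Proof. by case: monC. Qed.

Lemma sat_elem (V : Type) (phi : formula L (V + M)) (x : V -> M) :
  satp (idfun : M -> M) phi x <-> satp j phi (j \o x).
Proof.
rewrite !satpE elementaryP.
by have -> : j \o vapp x idfun = vapp (j \o x) j by apply: funext => -[].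
Qed.

Lemma coheir_comp U (V W : Type) (x : V -> C) (f : W -> V) c :
  coheir U x c -> coheir U (x \o f) c.
Proof.
move=> h phi.
pose g (w : 'I_n + W) : 'I_n + V := match w with inl k => inl k | inr w => inr (f w) end.
have E (d : Cn) : vapp d (x \o f) = vapp d x \o g by apply: funext => -[].
rewrite E -sat_rename h.
have -> // : [set m | sat (rename g phi) (vapp (j \o m) x)] =
             [set m | sat phi (vapp (j \o m) (x \o f))].
by apply/seteqP; split=> m /=; rewrite sat_rename E.
Qed.

Lemma coheir_same_type (a c : Cn) U (V : Type) (x : V -> C) : UltraFilter U ->
  (forall phi : formula L ('I_n + M), satp j phi a ->
      U [set m | satp (idfun : M -> M) phi m]) ->
  coheir U (vapp x j) c -> same_type a c.
Proof.
move=> UU Ua Uc phi.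
have {}Uc : coheir U j c.
  by have := coheir_comp (inr : M -> V + M) Uc; congr (coheir U _ c); apply: funext.
have E psi : U [set m | satp (idfun : M -> M) psi m] <-> satp j psi c.
  rewrite satpE Uc.
  have -> // : [set m | satp (idfun : M -> M) psi m] = [set m | sat psi (vapp (j \o m) j)].
  by apply/seteqP; split=> m /=; rewrite sat_elem.
split=> [/Ua/E//|h]; apply: contrapT => h'.
by have /Ua/E /(_ h) := (h' : satp j (Neg phi) a).
Qed.

Lemma coheir_move U (W : Type) (y : W -> C) (c d : Cn) : small W ->
  coheir U y c -> coheir U y d ->
  exists2 s, automorphism s & (forall w, s (y w) = y w) /\ s \o c = d.
Proof.
move=> sW hc hd; case: monC => _ _ hom.
have [||s saut sE] := homogeneous_map hom (x := vapp c y) (y := vapp d y).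
- exact (small_sum kappaP (small_ord kappaP n) sW).
- by move=> phi; rewrite hc hd.
exists s => //; split=> [w|]; first exact: (sE (inr w)).
by apply: funext => k; exact: (sE (inl k)).
Qed.

(** The type of [(a, c)] over M, for [c] a coheir over [a], is decided by which tuples [m] of M
    satisfy [phi] together with [a]. For fixed [m] this is a formula over M in [a], so only the type
    of [a] matters. *)
Lemma coheir_move2 U (a b c d : Cn) : same_type a b ->
  coheir U (vapp a j) c -> coheir U (vapp b j) d ->
  exists2 s, fixing s & s \o a = b /\ s \o c = d.
Proof.
move=> ab hc hd; case: monC => _ _ hom.
have [||s saut sE] := homogeneous_map hom (x := vapp c (vapp a j)) (y := vapp d (vapp b j)).
- by do 2 apply: (small_sum kappaP (small_ord kappaP n)).
- move=> phi; rewrite hc hd.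
  suff -> : [set m | sat phi (vapp (j \o m) (vapp a j))] =
            [set m | sat phi (vapp (j \o m) (vapp b j))] by [].
  pose g m (v : 'I_n + ('I_n + M)) : 'I_n + M :=
    match v with inl k => inr (m k) | inr w => w end.
  have E e m : sat phi (vapp (j \o m) (vapp e j)) <-> satp j (rename (g m) phi) e.
    rewrite satpE sat_rename.
    by have -> // : vapp (j \o m) (vapp e j) = vapp e j \o g m by apply: funext => -[].
  by apply/seteqP; split=> m /=; rewrite !E ab.
exists s; first by split=> // m; exact: (sE (inr (inr m))).
by split; apply: funext => k; [exact: (sE (inr (inl k)))|exact: (sE (inl k))].
Qed.

(* Choosing representatives of the classes, a coheir [c] of the type of [a] over
   them is equivalent to a representative [r], hence to a second coheir [d] over
   [r], [c]. As [(c, d)], [(a, c)] and [(b, c)] have the same type over M, so are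
   [a], [c] and [b]. *)
Lemma bounded_invariant_same_type (D : set Cn) (E : Cn -> Cn -> Prop) :
  (forall a b, same_type a b -> D a -> D b) ->
  (forall a, D a -> E a a) ->
  (forall a b, D a -> D b -> E a b -> E b a) ->
  (forall a b c, D a -> D b -> D c -> E a b -> E b c -> E a c) ->
  (forall s a b, fixing s -> D a -> D b -> E a b -> E (s \o a) (s \o b)) ->
  card_lt [set [set b | D b /\ E a b] | a in D] kappa ->
  forall a b, D a -> same_type a b -> E a b.
Proof.
move=> Dtype Erefl Esym Etrans Einv Ebdd a b Da ab.
have Db := Dtype _ _ ab Da.
have [U [UU Ua]] := coheir_filter a elementaryP.
case: monC => _ satC _.
set Q := [set _ | _ in _] in Ebdd.
have /choice[r rP] : forall q : set_type Q, exists a, D a /\ [set b | D b /\ E a b] = set_val q.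
  by move=> q; have /set_mem[a' Da' qE] := valP q; exists a'.
pose x := vapp (vapp a (vapp b (fun p : set_type Q * 'I_n => r p.1 p.2))) j.
have sI := small_ord kappaP n.
have [|c hc] := coheir_realizes j satC x UU.
  apply: small_sum => //; apply: small_sum => //; apply: small_sum => //.
  by apply: small_prod => //; apply: small_set_type.
have {}hc : coheir U x c by [].
have ac := coheir_same_type UU Ua hc.
have Dc := Dtype _ _ ac Da.
have Qc : Q [set b | D b /\ E c b] by exists c.
pose q : set_type Q := SigSub (mem_set Qc).
have [Dr rE] := rP q.
have Erc : E (r q) c.
  have : [set b | D b /\ E (r q) b] c by rewrite rE /=; split=> //; apply: Erefl.
  by case.
have [|d hd] := coheir_realizes j satC (vapp (vapp (r q) c) j) UU.
  by apply: small_sum => //; apply: small_sum.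
have {}hd : coheir U (vapp (vapp (r q) c) j) d by [].
have Dd := Dtype _ _ (coheir_same_type UU Ua hd) Da.
have h1 : coheir U (vapp (r q) j) c.
  have := coheir_comp (fun v => match v with
    | inl k => inl (inr (inr (q, k))) | inr m => inr m end) hc.
  by congr (coheir U _ c); apply: funext => -[].
have h2 : coheir U (vapp (r q) j) d.
  have := coheir_comp (fun v => match v with
    | inl k => inl (inl k) | inr m => inr m end) hd.
  by congr (coheir U _ d); apply: funext => -[].
have h3 : coheir U (vapp c j) d.
  have := coheir_comp (fun v => match v with
    | inl k => inl (inr k) | inr m => inr m end) hd.
  by congr (coheir U _ d); apply: funext => -[].
have h4 : coheir U (vapp a j) c.
  have := coheir_comp (fun v => match v with
    | inl k => inl (inl k) | inr m => inr m end) hc.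
  by congr (coheir U _ c); apply: funext => -[].
have h5 : coheir U (vapp b j) c.
  have := coheir_comp (fun v => match v with
    | inl k => inl (inr (inl k)) | inr m => inr m end) hc.
  by congr (coheir U _ c); apply: funext => -[].
have Erd : E (r q) d.
  have [|s saut [sr <-]] := coheir_move _ h1 h2; first exact: small_sum.
  rewrite -[r q](_ : s \o r q = _); last by apply: funext => k; exact: (sr (inl k)).
  by apply: Einv => //; split=> // m; exact: (sr (inr m)).
have Ecd : E c d by apply: (Etrans _ (r q)) => //; apply: Esym.
have Eac : E a c.
  have [|s sf [sa sc]] := coheir_move2 _ h3 h4; first by move=> phi; rewrite ac.
  by have := Einv _ _ _ sf Dc Dd Ecd; rewrite sa sc.
have Ebc : E b c.
  have [|s sf [sb sc]] := coheir_move2 _ h3 h5; first by move=> phi; rewrite -ac ab.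
  by have := Einv _ _ _ sf Dc Dd Ecd; rewrite sb sc.
by apply: (Etrans _ c) => //; apply: Esym.
Qed.

End BoundedInvariant.

(** * The group of the monster model *)

Section ElementarySets.
Context (L : language) (M C : structure L) (j : M -> C).
Hypothesis ej : elementary j.

(** A tuple of C satisfying [phi] but not [psi] makes an existential sentence over M true, and
    elementarity yields such a tuple in M. [V] is enumerated because [ExTuple] quantifies over
    ['I_n]. *)
Lemma elementary_sub (V : finType) (phi psi : formula L (V + M)) :
  (forall x, satp (idfun : M -> M) phi x -> satp (idfun : M -> M) psi x) ->
  forall c, satp j phi c -> satp j psi c.
Proof.
move=> h c hc; apply: contrapT => nc.
pose f (v : V + M) : 'I_#|V| + M := match v with inl k => inl (enum_rank k) | inr m => inr m end.
have : sat (ExTuple (rename f (Conj phi (Neg psi)))) (j \o idfun).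
  apply/sat_ExTuple; exists (c \o enum_val); rewrite sat_rename.
  have -> : vapp (c \o enum_val) (j \o idfun) \o f = vapp c j.
    by apply: funext => -[k|m] //=; rewrite enum_rankK.
  by rewrite sat_Conj.
move=> /ej/sat_ExTuple[y /sat_rename].
have -> : vapp y idfun \o f = vapp (y \o enum_rank) idfun by apply: funext => -[].
by rewrite sat_Conj => -[/h hp]; apply.
Qed.

Lemma star_defines (V : finType) (D : set (V -> M)) (phi : formula L (V + M)) c :
  defines phi D -> star j D c <-> satp j phi c.
Proof.
move=> phiD; split=> [[psi psiD]|hc]; last by exists phi.
apply: elementary_sub => x.
by rewrite -[satp _ psi x]/([set x | satp idfun psi x] x) -psiD phiD.
Qed.

End ElementarySets.

(** * Interpretations in the two languages, and [G^*] as an abstract group *)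

Section ReductStar.
Context (L L' : language) (i : sublanguage L L') (M C : structure L') (j : M -> C).
Hypothesis ej : elementary j.

Lemma satp_lift (N : structure L') (h : M -> N) (V : Type) (phi : formula L (V + M)) x :
  satp h (lift_formula i phi) x <-> @satp L (reduct i N) M h V phi x.
Proof. by rewrite !satpE sat_lift. Qed.

Lemma defines_lift (V : Type) (D : set (V -> M)) (phi : formula L (V + M)) :
  @defines L (reduct i M) V phi D -> defines (lift_formula i phi) D.
Proof. by move=> ->; apply/seteqP; split=> x /satp_lift. Qed.

Lemma star_reduct (V : finType) (D : set (V -> M)) (phi : formula L (V + M)) c :
  @defines L (reduct i M) V phi D ->
  star j D c <-> @satp L (reduct i C) M j V phi c.
Proof. by move=> /defines_lift/(star_defines ej) ->; exact: satp_lift. Qed.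

Context (G : definable_group (reduct i M)).
Notation n := (dg_dim G).

(** Presents [G^*] as the bijective image of a [groupType], so that later computations take place in
    a group rather than with the relation [star_mul]. *)
Record group_extension (K : groupType) (val : K -> 'I_n -> C) (c : G -> K) := {
  ge_inj : injective val;
  ge_range : range val = Gstar j (G := G);
  ge_mul : forall a b d, star_mul j (G := G) (val a) (val b) (val d) <-> (a * b)%g = d;
  ge_cst : forall g, val (c g) = j \o dg_emb g }.

Lemma mul_graphP (a b d : G) :
  mul_graph (vapp (vapp (dg_emb a) (dg_emb b)) (dg_emb d)) <-> (a * b)%g = d.
Proof.
split=> [[g [h /funeqP E]]|<-]; last by exists a, b.
have -> : a = g by apply: (@dg_emb_inj _ _ G); apply: funext => k; exact: (E (inl (inl k))).
have -> : b = h by apply: (@dg_emb_inj _ _ G); apply: funext => k; exact: (E (inl (inr k))).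
by apply: (@dg_emb_inj _ _ G); apply: funext => k; exact/esym/(E (inr k)).
Qed.

Lemma extension_of_star (K : Type) (val : K -> 'I_n -> C) (mulK : K -> K -> K -> Prop)
    (c : G -> K) : elementary (j : reduct i M -> reduct i C) ->
  injective val -> range val = Gstar j (G := G) ->
  (forall a b d, star_mul j (G := G) (val a) (val b) (val d) <-> mulK a b d) ->
  (forall g, val (c g) = j \o dg_emb g) ->
  inhabited (@extension L (reduct i M) (reduct i C) j G K n (@dg_emb _ _ G) val
    (fun a b d => (a * b)%g = d) mulK c).
Proof.
move=> eL vi vr vm vc.
have [phi phiP] := dg_definable G; have [psi psiP] := dg_mul_definable G.
constructor; apply: (@Extension L (reduct i M) (reduct i C) j G K n (@dg_emb _ _ G) val _ mulK c
  eL (@dg_emb_inj _ _ G) vi vc phi _ _ psi).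
- by move=> x; rewrite phiP.
- by move=> x; rewrite vr /Gstar /star_of (star_reduct _ phiP).
- by move=> a b d; rewrite -mul_graphP /mul_graph psiP.
- by move=> a b d; rewrite -vm /star_mul (star_reduct _ psiP).
Qed.

Lemma extension_lift (K : Type) (val : K -> 'I_n -> C) mulG mulK (c : G -> K) :
  @extension L (reduct i M) (reduct i C) j G K n (@dg_emb _ _ G) val mulG mulK c ->
  @extension L' M C j G K n (@dg_emb _ _ G) val mulG mulK c.
Proof.
move=> E.
apply: (@Extension L' M C j G K n (@dg_emb _ _ G) val mulG mulK c ej (ext_emb_inj E)
  (ext_val_inj E) (ext_cst E) (lift_formula i (ext_in E)) _ _
  (lift_formula i (ext_mul E))) => *.
- by rewrite -(ext_inG E); exact: satp_lift.
- by rewrite -(ext_inK E); exact: satp_lift.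
- by rewrite -(ext_mulG E); exact: satp_lift.
- by rewrite -(ext_mulK E); exact: satp_lift.
Qed.

Lemma constant_Gstar (g : G) : Gstar j (G := G) (j \o dg_emb g).
Proof.
have [phi phiP] := dg_definable G.
rewrite /Gstar /star_of (star_defines ej _ (defines_lift phiP)).
rewrite satpE -[vapp _ _](_ : j \o vapp (dg_emb g) idfun = _); last by apply: funext => -[].
rewrite -ej; apply/satp_lift.
have : range (@dg_emb _ _ G) (dg_emb g) by exists g.
by rewrite phiP.
Qed.

(** The group axioms for G are transferred one by one to the relation [star_mul]. Totality and
    uniqueness of products, and existence of inverses, then give the operations by choice. *)
Lemma group_extension_exists : elementary (j : reduct i M -> reduct i C) ->
  exists (K : groupType) (val : K -> 'I_n -> C) (c : G -> K), group_extension val c.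
Proof.
move=> eL; pose K0 := {classic {x : 'I_n -> C | Gstar j (G := G) x}}.
pose v0 : K0 -> 'I_n -> C := @proj1_sig _ _.
pose c0 (g : G) : K0 := exist _ _ (constant_Gstar g).
pose mulK (a b d : K0) := star_mul j (G := G) (v0 a) (v0 b) (v0 d).
have v0i : injective v0 by move=> [x px] [y py] /= xy; apply: eq_exist.
have v0r : range v0 = Gstar j (G := G).
  by apply/seteqP; split=> [_ [[x px] _ <-]//|x px]; exists (exist _ x px).
have [E] := @extension_of_star K0 v0 mulK c0 eL v0i v0r (fun _ _ _ => iff_refl _) (fun _ => erefl).
(* [T] transfers sentences, whose free variables range over [void]. In them [None] is the innermost
   bound variable and each [Some] steps out by one quantifier. *)
pose T phi := (gsat_transfer E phi (fun v : void => match v with end)).1.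
have tot (p : K0 * K0) : exists d, mulK p.1 p.2 d.
  case: p => a b; move: a b.
  refine (T (GAll (GAll (GEx (GMul (Some (Some None)) (Some None) None)))) _) => /= a b.
  by exists (a * b)%g.
have /choice[mul mulP] := tot.
have fn : forall a b d d', mulK a b d -> mulK a b d' -> d = d'.
  refine (T (GAll (GAll (GAll (GAll (GImp
    (GMul (Some (Some (Some None))) (Some (Some None)) (Some None))
    (GImp (GMul (Some (Some (Some None))) (Some (Some None)) None)
      (GEq (Some None) None))))))) _) => /=.
  by move=> ? ? ? ? <- <-.
have asc : forall a b d ab bd r, mulK a b ab -> mulK b d bd -> mulK ab d r -> mulK a bd r.
  refine (T (GAll (GAll (GAll (GAll (GAll (GAll (GImp
    (GMul (Some (Some (Some (Some (Some None))))) (Some (Some (Some (Some None)))) (Some (Some None)))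
    (GImp (GMul (Some (Some (Some (Some None)))) (Some (Some (Some None))) (Some None))
    (GImp (GMul (Some (Some None)) (Some (Some (Some None))) None)
      (GMul (Some (Some (Some (Some (Some None))))) (Some None) None)))))))))) _) => /=.
  by move=> ? ? ? ? ? ? <- <- <-; rewrite mulgA.
(* The variable [None] is replaced by the constant 1 of G; [S2] does the same under one more
   quantifier. *)
pose S1 := fun v : option (option void) => match v with
  | None => inr (1%g : G) | Some None => inl (None : option void) | Some (Some w) => match w with end end.
have unit_l : forall a, mulK (c0 1%g) a a.
  refine (T (GAll (GSub S1 (GMul None (Some None) (Some None)))) _) => /= a.
  exact: mul1g.
have unit_r : forall a, mulK a (c0 1%g) a.
  refine (T (GAll (GSub S1 (GMul (Some None) None (Some None)))) _) => /= a.
  exact: mulg1.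
pose S2 := fun v : option (option (option void)) => match v with
  | None => inr (1%g : G) | Some w => inl (w : option (option void)) end.
have inve a : exists b, mulK b a (c0 1%g) /\ mulK a b (c0 1%g).
  move: a.
  refine (T (GAll (GEx (GSub S2 (GAnd (GMul (Some None) (Some (Some None)) None)
     (GMul (Some (Some None)) (Some None) None))))) _) => /= a.
  by exists (a^-1)%g; rewrite mulVg mulgV.
have /choice[inv invP] := inve.
have mE a b d : mulK a b d -> mul (a, b) = d by exact: fn (mulP (a, b)).
pose m a b := mul (a, b).
have mulA : associative m.
  move=> a b d; apply: mE; apply: (asc a b d) (mulP (a, b)) (mulP (b, d)) (mulP (_, d)).
pose K : groupType := HB.pack K0 (isGroup.Build K0 mulA (fun a => mE _ _ _ (unit_l a))
  (fun a => mE _ _ _ (unit_r a)) (fun a => mE _ _ _ (invP a).1) (fun a => mE _ _ _ (invP a).2)).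
exists K, v0, c0; split=> // a b d; split=> [/mE//|<-].
exact: (mulP (a, b)).
Qed.

End ReductStar.

(** * The Massicot-Wagner argument *)

Section Generic.
Context (G : groupType).
Local Open Scope group_scope.

Definition ltrans (g : G) (B : set G) : set G := [set x | B (g^-1 * x)].
Definition sprod (A B : set G) : set G := [set x | exists a b, [/\ A a, B b & a * b = x]].

(* [U] accumulates the translates of [T] which have already been chosen. *)
Fixpoint tcover (N : nat) (T U : set G) : Prop :=
  match N with
  | 0 => forall y, U y
  | N'.+1 => exists g, tcover N' T (U `|` ltrans g T)
  end.

(* A first-order substitute for a lower bound on the measure of [B]: it makes the set
   [S] of the Massicot-Wagner argument definable. *)
Fixpoint big (N d : nat) (B : set G) : Prop :=
  match d with
  | 0 => exists x, B x
  | d'.+1 => tcover N [set g | big N d' (ltrans g B `&` B)] set0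
  end.

Lemma tcover_mono N (T T' U U' : set G) :
  T `<=` T' -> U `<=` U' -> tcover N T U -> tcover N T' U'.
Proof.
elim: N U U' => [|N IH] U U' TT UU /=; first by move=> h y; apply: UU.
move=> [g h]; exists g; apply: IH h => // x [/UU|/TT]; first by left.
by right.
Qed.

Lemma tcover_full N (T U : set G) : (forall y, U y) -> tcover N T U.
Proof.
by elim: N U => [//|N IH] U h /=; exists 1; apply: IH => y; left.
Qed.

Lemma tcover_le N N' (T U : set G) : (N <= N')%N -> tcover N T U -> tcover N' T U.
Proof.
elim: N N' U => [|N IH] [|N'] U //= NN'; first by move=> h; apply: (tcover_full N'.+1).
by move=> [g h]; exists g; apply: IH h.
Qed.

Lemma tcover_seq N (T U : set G) : tcover N T U ->
  exists s : seq G, forall y, U y \/ exists2 g, g \in s & T (g^-1 * y).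
Proof.
elim: N U => [|N IH] U /=; first by move=> h; exists [::] => y; left.
move=> [g /IH[s sP]]; exists (g :: s) => y.
case: (sP y) => [[Uy|Ty]|[k ks Tk]]; first by left.
- by right; exists g; rewrite ?inE ?eqxx.
- by right; exists k; rewrite ?inE ?ks ?orbT.
Qed.

Lemma big_le N N' d (B : set G) : (N <= N')%N -> big N d B -> big N' d B.
Proof.
move=> NN; elim: d B => [//|d IH] B /= h.
by apply: tcover_le NN _; apply: tcover_mono h => // g; apply: IH.
Qed.

Lemma big_neq0 N d (B : set G) : big N d B -> exists x, B x.
Proof.
elim: d B => [//|d IH] B /= /tcover_seq[s /(_ 1)[//|[g _ /IH[x [_ Bx]]]]].
by exists x.
Qed.

End Generic.

(** * Finitely additive left-invariant means and almost stabilizers *)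

Section MassicotWagner.
Context (R : realType) (G : groupType) (Good : set (set G)) (m : set G -> R).
Local Open Scope ring_scope.
Hypothesis GoodI : forall A B, Good A -> Good B -> Good (A `&` B).
Hypothesis GoodC : forall A, Good A -> Good (~` A).
Hypothesis Good_ltrans : forall g A, Good A -> Good (ltrans g A).
Hypothesis Good_sprod : forall A B, Good A -> Good B -> Good (sprod A B).
Hypothesis m_ge0 : forall A, Good A -> 0 <= m A.
Hypothesis m_le1 : forall A, Good A -> m A <= 1.
Hypothesis m_add : forall A B, Good A -> Good B -> A `&` B = set0 ->
  m (A `|` B) = m A + m B.
Hypothesis m_ltrans : forall g A, Good A -> m (ltrans g A) = m A.

Lemma GoodU A B : Good A -> Good B -> Good (A `|` B).
Proof. by move=> gA gB; rewrite -[_ `|` _]setCK setCU; apply: GoodC; apply: GoodI; apply: GoodC. Qed.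

Lemma Good0 B : Good B -> Good set0.
Proof. by move=> gB; rewrite -(setICr B); apply: GoodI => //; apply: GoodC. Qed.

Lemma m_set0 B : Good B -> m set0 = 0.
Proof.
by move=> /Good0 g0; have := m_add g0 g0; rewrite setI0 setU0 => /(_ erefl); lra.
Qed.

Lemma GoodD A B : Good A -> Good B -> Good (A `\` B).
Proof. by move=> gA gB; rewrite setDE; apply: GoodI => //; apply: GoodC. Qed.

Lemma m_setID A B : Good A -> Good B -> m A = m (A `&` B) + m (A `\` B).
Proof.
move=> gA gB; have E : A = (A `&` B) `|` (A `\` B) by rewrite setUIDK.
rewrite {1}E m_add //; [exact: GoodI|exact: GoodD|].
by apply/seteqP; split=> x // [[_ ?] []].
Qed.

Lemma m_mono A B : Good A -> Good B -> A `<=` B -> m A <= m B.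
Proof.
move=> gA gB AB; rewrite (m_setID gB gA) setIC (setIidl AB) lerDl.
by apply: m_ge0; apply: GoodD.
Qed.

Lemma m_setU A B : Good A -> Good B -> m (A `|` B) = m A + m B - m (A `&` B).
Proof.
move=> gA gB; rewrite (_ : A `|` B = A `|` (B `\` A)); last first.
  by apply/seteqP; split=> x [Ax|]; [by left| | by left|by case; right];
     have [Ax|nAx] := pselect (A x); [left|right].
rewrite m_add//; [|exact: GoodD|by apply/seteqP; split=> x // [? []]].
by rewrite (m_setID gB gA) setIC; lra.
Qed.

Lemma m_subadd A B : Good A -> Good B -> m (A `|` B) <= m A + m B.
Proof.
by move=> gA gB; rewrite m_setU// lerBlDr lerDl; apply: m_ge0; apply: GoodI.
Qed.

Lemma ltransM (g h : G) (A : set G) : ltrans g (ltrans h A) = ltrans (g * h)%g A.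
Proof. by apply/seteqP; split=> x; rewrite /ltrans /= invgM mulgA. Qed.

Lemma ltrans1 (A : set G) : ltrans 1%g A = A.
Proof. by apply/seteqP; split=> x; rewrite /ltrans /= invg1 mul1g. Qed.

Lemma ltransI (g : G) (A B : set G) : ltrans g (A `&` B) = ltrans g A `&` ltrans g B.
Proof. by []. Qed.

Lemma ltrans_sprod (g : G) (A B : set G) : ltrans g (sprod A B) = sprod (ltrans g A) B.
Proof.
apply/seteqP; split=> x.
  move=> [a [b [Aa Bb abx]]]; exists (g * a)%g, b; split=> //.
    by rewrite /ltrans /= mulKg.
  by rewrite -mulgA abx mulVKg.
by move=> [a [b [Aa Bb <-]]]; exists (g^-1 * a)%g, b; split=> //; rewrite mulgA.
Qed.

(* The sets [y_i B] for pairwise "far" elements [y_1, ..., y_k] overlap in measure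
   at most [s], so their union has measure at least [k t - k^2 s]. *)
Lemma tcover_or_large (B : set G) (t s : R) : Good B -> t <= m B ->
  forall N k (U V : set G), Good V ->
    (forall y, ~ U y -> m (ltrans y B `&` V) <= k%:R * s) ->
    k%:R * t - k%:R ^+ 2 * s <= m V ->
    ~ tcover N [set g | s <= m (ltrans g B `&` B)] U ->
    0 <= s ->
    exists2 W, Good W & (k + N)%:R * t - (k + N)%:R ^+ 2 * s <= m W.
Proof.
move=> gB tB; elim=> [|N IH] k U V gV hU hV /= ncov s0.
  by exists V => //; rewrite addn0.
have [y nUy] : exists y, ~ U y.
  apply: contrapT => /forallNP h; apply: ncov; exists 1%g.
  by apply: tcover_full => y; left; apply: contrapT.
have gyB := Good_ltrans y gB.
rewrite -addSnnS; apply: (IH _ (U `|` ltrans y [set g | s <= m (ltrans g B `&` B)])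
  (V `|` ltrans y B)) => //.
- exact: GoodU.
- move=> z /not_orP[/hU Uz] /= /negP; rewrite -ltNge => zy.
  have gzB := Good_ltrans z gB.
  rewrite setIUr; apply: le_trans (m_subadd _ _) _; [exact: GoodI|exact: GoodI|].
  suff : m (ltrans z B `&` ltrans y B) <= s by rewrite -natr1; lra.
  rewrite -(m_ltrans y^-1%g); last exact: GoodI.
  by rewrite ltransI !ltransM mulVg ltrans1; apply: ltW.
- rewrite m_setU// m_ltrans// setIC; have := hU _ nUy.
  have := mulr_ge0 (ler0n R k) s0.
  by rewrite -natr1; nra.
- by move=> h; apply: ncov; exists y.
Qed.

Lemma tcover_overlap (t : R) : 0 < t -> exists (N : nat) (s : R), 0 < s /\
  forall B, Good B -> t <= m B -> tcover N [set g | s <= m (ltrans g B `&` B)] set0.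
Proof.
move=> t0; have t20 : 0 <= 2 / t by rewrite divr_ge0// ltW.
(* With N t > 2 and s = 1 / (2 N^2), the bound N t - N^2 s exceeds 2 - 1/2, whereas all measures are
   at most 1. *)
pose N := Num.bound (2 / t).
have Nt : 2 < N%:R * t by rewrite -ltr_pdivrMr//; exact: archi_boundP.
have N0 : 0 < (N%:R : R) by apply: le_lt_trans (archi_boundP t20).
exists N, (N%:R ^- 2 / 2); split=> [|B gB tB].
  by rewrite divr_gt0// invr_gt0 exprn_gt0.
apply: contrapT => ncov.
have s0 : 0 <= N%:R ^- 2 / 2 :> R by rewrite divr_ge0// invr_ge0 exprn_ge0.
have m0 := m_set0 gB.
have [||W gW] := tcover_or_large gB tB (Good0 gB) (k := 0) _ _ ncov s0.
- by move=> y _; rewrite setI0 mul0r m0.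
- by rewrite mul0r expr0n /= mul0r subr0 m0.
rewrite add0n => hW; have := m_le1 gW.
have -> : 1 = (N%:R * N%:R ^- 1) ^+ 2 :> R by rewrite divff ?expr1n// gt_eqF.
move: hW; rewrite exprMn exprVn mulrA divff ?gt_eqF ?exprn_gt0//.
lra.
Qed.

(** Induction on [d]: by [tcover_overlap], boundedly many translates of the set of [g] with m (gB /\
    B) >= s cover G, and such intersections are [d]-large by induction. The bound depends on [d] and
    [t] but not on [B]. *)
Lemma big_of_measure (d : nat) (t : R) : 0 < t -> exists N, 
  forall B, Good B -> t <= m B -> big N d B.
Proof.
elim: d t => [|d IH] t t0.
  exists 0 => B gB tB /=; apply: contrapT => /forallNP B0.
  have B0' : B = set0 by apply/seteqP; split=> x // /B0.
  by have := m_set0 gB; rewrite -B0'; lra.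
have [N [s [s0 Nc]]] := tcover_overlap t0; have [N' N'b] := IH _ s0.
exists (maxn N N') => B gB tB /=.
apply: tcover_le (leq_maxl _ _) _; apply: tcover_mono (Nc _ gB tB) => // g sg.
apply: big_le (leq_maxr _ _) _; apply: N'b sg.
by apply: GoodI => //; apply: Good_ltrans.
Qed.

(** Descent on [d]: as long as some [d]-large subset of [B] lowers m (BA) by more than [eps], it
    replaces [B]. The descent stops before [d] runs out, because m (BA) >= m A for every nonempty
    [B]. *)
Lemma almost_minimal (A : set G) (N : nat) (eps : R) : Good A -> 0 < eps ->
  forall d B, Good B -> B `<=` A -> big N d B -> m (sprod B A) < m A + d%:R * eps ->
  exists d' B', [/\ Good B', B' `<=` A, big N d'.+1 B' &
    forall B'', Good B'' -> B'' `<=` B' -> big N d' B'' ->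
      m (sprod B' A) - eps <= m (sprod B'' A)].
Proof.
move=> gA e0; elim=> [|d IH] B gB BA Bb hB.
  have [x Bx] := Bb; exfalso.
  have : m (ltrans x A) <= m (sprod B A).
    apply: m_mono; [exact: Good_ltrans|exact: Good_sprod|].
    by move=> y Ay; exists x, (x^-1 * y)%g; split=> //; rewrite mulVKg.
  by rewrite m_ltrans//; lra.
have [h|/existsNP[B' /not_implyP[gB' /not_implyP[B'B /not_implyP[bB' /negP]]]]] :=
  pselect (forall B'', Good B'' -> B'' `<=` B -> big N d B'' ->
      m (sprod B A) - eps <= m (sprod B'' A)); first by exists d, B.
rewrite -ltNge => h; apply: (IH B') => //; first by move=> x /B'B/BA.
by move: hB; rewrite -natr1; lra.
Qed.

Definition shift_le (Y : set G) (e : R) : set G :=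
  [set g | m (ltrans g Y `\` Y) <= e].

(** Since gY and Y have the same measure, so have the differences gY - Y and Y - gY. *)
Lemma shift_leV (Y : set G) (e : R) g : Good Y -> shift_le Y e g -> shift_le Y e g^-1%g.
Proof.
move=> gY; have gg := Good_ltrans g gY; rewrite /shift_le /=; apply: le_trans.
have -> : m (ltrans g^-1%g Y `\` Y) = m (Y `\` ltrans g Y).
  have <- : ltrans g (ltrans g^-1%g Y `\` Y) = Y `\` ltrans g Y.
    by rewrite -[ltrans g _]/(ltrans g (ltrans g^-1%g Y) `\` _) ltransM mulgV ltrans1.
  by rewrite m_ltrans//; apply: GoodD => //; exact: Good_ltrans.
have := m_setID gY gg; have := m_setID gg gY; rewrite m_ltrans// setIC; lra.
Qed.

(** The difference ghY - Y is covered by g (hY - Y) and gY - Y. *)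
Lemma shift_leM (Y : set G) (e e' : R) g h : Good Y ->
  shift_le Y e g -> shift_le Y e' h -> shift_le Y (e + e') (g * h)%g.
Proof.
move=> gY; rewrite /shift_le /= => ge he.
have gg := Good_ltrans g gY; have gh := Good_ltrans h gY.
have ggh := Good_ltrans g gh.
apply: (@le_trans _ _ (m (ltrans g (ltrans h Y `\` Y) `|` (ltrans g Y `\` Y)))).
  apply: m_mono; [|by apply: GoodU; [apply: Good_ltrans|]; apply: GoodD|].
    by rewrite -ltransM; apply: GoodD.
  rewrite -ltransM => x [hx nx]; have [gx|ngx] := pselect (ltrans g Y x).
    by right.
  by left.
apply: le_trans (m_subadd _ _) _; [by apply: Good_ltrans; apply: GoodD|exact: GoodD|].
by rewrite m_ltrans; [rewrite addrC lerD|apply: GoodD].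
Qed.

Lemma shift_le_meet (Y : set G) (e : R) g : Good Y -> e < m Y -> shift_le Y e g ->
  exists x y, [/\ Y x, Y y & g = (x * y^-1)%g].
Proof.
move=> gY eY ge.
have [x [gx Yx]] : exists x, ltrans g Y x /\ Y x.
  apply: contrapT => /forallNP h; move: ge; apply/negP; rewrite -ltNge.
  have -> : ltrans g Y `\` Y = ltrans g Y.
    by apply/seteqP; split=> [x []//|x gx]; split=> // Yx; apply: (h x).
  by rewrite m_ltrans.
by exists x, (g^-1 * x)%g; split=> //; rewrite invgM invgK mulVKg.
Qed.

Definition pow4 (A : set G) : set G := sprod (sprod A A) (sprod A A).
Definition quot (A : set G) : set G := [set x | exists g h, [/\ A g, A h & g^-1 * h = x]%g].

(* Each [g] in [S] moves [BA] by a set of measure at most [eps]: since [gB] meets [B]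
   in a big set, [g(BA)] and [BA] share [(gB /\ B)A], of almost full measure. *)

Theorem massicot_wagner (A : set G) : Good A -> 0 < m A ->
  (forall x, A x -> A x^-1%g) ->
  exists B N d, [/\ Good B, big N d.+1 B &
    let W := quot [set g | big N d (ltrans g B `&` B)] in
    sprod (pow4 W) (pow4 W) `<=` pow4 A].
Proof.
(* An element of [W] moves [Y] by at most 2 eps, so a product of eight of them moves it by at most
   16 eps. The constant 17 keeps this below m A. *)
move=> gA mA Asym; pose eps := m A / 17.
have e0 : 0 < eps by rewrite /eps; lra.
(* The number of steps allowed to the descent: m (AA) <= 1 < m A + d0 eps. *)
pose d0 := Num.bound (1 / eps).
have d0P : 1 < d0%:R * eps.
  by rewrite -ltr_pdivrMr//; apply: archi_boundP; rewrite divr_ge0// ltW.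
have [N NP] := big_of_measure d0 mA.
have [|d [B [gB BA bB Bmin]]] := almost_minimal gA e0 gA (@subset_refl _ A) (NP _ gA (lexx _)).
  by have := m_le1 (Good_sprod gA gA); lra.
exists B, N, d; split=> // W.
pose Y := sprod B A; have gY : Good Y by exact: Good_sprod.
have YA : m A <= m Y.
  have [x Bx] := big_neq0 bB; rewrite -(m_ltrans x)//.
  apply: m_mono => //; first exact: Good_ltrans.
  by move=> y Ay; exists x, (x^-1 * y)%g; split=> //; rewrite mulVKg.
have Sshift : [set g | big N d (ltrans g B `&` B)] `<=` shift_le Y eps.
  move=> g /= bg; have ggB := Good_ltrans g gB; have ggY := Good_ltrans g gY.
  have := Bmin _ (GoodI ggB gB) (@subIsetr _ _ _) bg.
  have : m (sprod (ltrans g B `&` B) A) <= m (ltrans g Y `&` Y).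
    apply: m_mono; [by apply: Good_sprod => //; exact: GoodI|exact: GoodI|].
    rewrite /Y ltrans_sprod => x [b [a [[gb Bb] Aa <-]]].
    by split; exists b, a.
  have := m_setID ggY gY; rewrite m_ltrans// /shift_le /=; lra.
have prodS e e' U V : U `<=` shift_le Y e -> V `<=` shift_le Y e' ->
    sprod U V `<=` shift_le Y (e + e').
  by move=> Ue Ve _ [x [y [/Ue xe /Ve ye <-]]]; exact: shift_leM.
have WS : W `<=` shift_le Y (eps + eps).
  move=> _ [g [h [/Sshift ge /Sshift he <-]]].
  by apply: shift_leM => //; exact: shift_leV.
have W4 := prodS _ _ _ _ (prodS _ _ _ _ WS WS) (prodS _ _ _ _ WS WS).
move=> g /(prodS _ _ _ _ W4 W4) /(shift_le_meet gY)[|x [y [Yx Yy ->]]].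
  by apply: lt_le_trans YA; rewrite /eps; lra.
move: Yx Yy => [b [a [/BA Ab Aa <-]]] [b' [a' [/BA Ab' Aa' <-]]].
exists (b * a)%g, (b' * a')^-1%g; split=> //; first by exists b, a.
by exists a'^-1%g, b'^-1%g; split; [exact: Asym|exact: Asym|rewrite invgM].
Qed.

End MassicotWagner.

(** * Definable thick sets *)

Section Fiber.
Context (P G D : Type) (pr : P -> set D) (mul : D -> D -> D -> Prop) (c : G -> D).

Definition gfiber (I : Type) (T : gform P G (option I)) (x : I -> D) : set D :=
  [set y | gsat pr mul c T (fun v => oapp x y v)].

End Fiber.

(** * First-order formulas for covers, large sets and thick sets *)

Section GroupFormulas.
Context (P G : Type).

(** [skip1] and [skip2] insert one or two new variables between the element variable [None] and the
    parameters [Some i]. *)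
Definition skip1 (I : Type) (v : option I) : option (option I) + G :=
  inl (if v is Some i then Some (Some i) else None).
Definition skip2 (I : Type) (v : option I) : option (option (option I)) + G :=
  inl (if v is Some i then Some (Some (Some i)) else None).

(** The formula counterpart of [tcover]. The translating element [g] is a new quantified variable,
    and membership of [y] in [gT] is expressed by some [s] in [T] with g s = y. *)
Fixpoint gcover (N : nat) (I : Type) (T U : gform P G (option I)) : gform P G I :=
  match N with
  | 0 => GAll U
  | N'.+1 => GEx (gcover N' (GSub (@skip1 I) T)
      (GOr (GSub (@skip1 I) U)
           (GEx (GAnd (GSub (@skip2 I) T) (GMul (Some (Some None)) None (Some None))))))
  end.

Definition gmeet (I : Type) (B : gform P G (option I)) : gform P G (option (option I)) :=
  GAnd (GEx (GAnd (GSub (@skip2 I) B) (GMul (Some (Some None)) None (Some None))))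
       (GSub (@skip1 I) B).

Fixpoint gbig (N d : nat) (I : Type) (B : gform P G (option I)) : gform P G I :=
  match d with
  | 0 => GEx B
  | d'.+1 => gcover N (gbig N d' (gmeet B)) (GNot GTrue)
  end.

Fixpoint gagree (I : Type) (F : seq P) (a b : I) : gform P G I :=
  match F with
  | [::] => GTrue
  | A :: F' => GAnd (GAnd (GImp (GIn A a) (GIn A b)) (GImp (GIn A b) (GIn A a)))
                    (gagree F' a b)
  end.

Definition gprod (p q : gform P G unit) : gform P G unit :=
  GEx (GEx (GAnd (GAnd (GSub (fun _ => inl (Some None)) p) (GSub (fun _ => inl None) q))
                 (GMul (Some None) None (Some (Some tt))))).

Definition gmoves (F : seq P) : gform P G unit :=
  GEx (GEx (GAnd (GMul (Some None) (Some (Some tt)) None) (gagree F (Some None) None))).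

Definition gthick (A : P) (F : seq P) : gform P G unit :=
  gprod (GIn A tt) (gprod (gmoves F) (GIn A tt)).

Definition gpow4 (p : gform P G unit) := gprod (gprod p p) (gprod p p).

Section Semantics.
Context (D : groupType) (pr : P -> set D) (c : G -> D).
Local Open Scope group_scope.
Notation mulD := (fun a b d : D => a * b = d).
Notation sat_ := (gsat pr mulD c).
Notation sec := (gfiber pr mulD c).

Lemma sec_skip1 (I : Type) (T : gform P G (option I)) (x : I -> D) g :
  sec (GSub (@skip1 I) T) (fun v => oapp x g v) = sec T x.
Proof.
by apply/seteqP; split=> y; rewrite /gfiber /=; congr (gsat _ _ _ T _);
  apply: funext => -[].
Qed.

Lemma sat_skip2 (I : Type) (T : gform P G (option I)) (x : I -> D) g y s :
  sat_ (GSub (@skip2 I) T) (fun v => oapp (fun v => oapp (fun v => oapp x g v) y v) s v) <->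
  sec T x s.
Proof.
suff -> : sec T x s = sat_ (GSub (@skip2 I) T)
    (fun v => oapp (fun v => oapp (fun v => oapp x g v) y v) s v) by [].
by rewrite /gfiber /=; congr (gsat _ _ _ T _); apply: funext => -[].
Qed.

Lemma sat_gcover N (I : Type) (T U : gform P G (option I)) (x : I -> D) :
  sat_ (gcover N T U) x <-> tcover N (sec T x) (sec U x).
Proof.
elim: N I T U x => [//|N IH] I T U x.
suff E g : sat_ (gcover N (GSub (@skip1 I) T)
      (GOr (GSub (@skip1 I) U)
           (GEx (GAnd (GSub (@skip2 I) T) (GMul (Some (Some None)) None (Some None))))))
      (fun v => oapp x g v) <-> tcover N (sec T x) (sec U x `|` ltrans g (sec T x)).
  by split=> -[g /E h]; exists g.
rewrite IH sec_skip1.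
suff -> : sec (GOr (GSub (@skip1 I) U)
           (GEx (GAnd (GSub (@skip2 I) T) (GMul (Some (Some None)) None (Some None)))))
          (fun v => oapp x g v) = sec U x `|` ltrans g (sec T x) by [].
rewrite -(sec_skip1 U x g); apply/seteqP; split=> y.
  case=> [Uy|[s [Ts /= E]]]; first by left.
  by right; rewrite /ltrans /= -E mulKg; apply/(sat_skip2 T x g y s).
case=> [Uy|Ty]; first by left.
by right; exists (g^-1 * y); split; [apply/(sat_skip2 T x g y)|rewrite /= mulVKg].
Qed.

Lemma sec_gmeet (I : Type) (B : gform P G (option I)) (x : I -> D) g :
  sec (gmeet B) (fun v => oapp x g v) = ltrans g (sec B x) `&` sec B x.
Proof.
rewrite -[X in _ `&` X](sec_skip1 B x g); apply/seteqP; split=> y.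
  move=> [[s [Bs /= E]] By]; split=> //.
  by rewrite /ltrans /= -E mulKg; apply/(sat_skip2 B x g y s).
move=> [gy By]; split=> //; exists (g^-1 * y).
by split; [apply/(sat_skip2 B x g y)|rewrite /= mulVKg].
Qed.

Lemma sat_gbig N d (I : Type) (B : gform P G (option I)) (x : I -> D) :
  sat_ (gbig N d B) x <-> big N d (sec B x).
Proof.
elim: d I B x => [//|d IH] I B x /=.
rewrite sat_gcover.
have -> : sec (GNot GTrue) x = set0 by apply/seteqP; split=> y //; apply.
suff -> : sec (gbig N d (gmeet B)) x =
          [set g | big N d (ltrans g (sec B x) `&` sec B x)] by [].
by apply/seteqP; split=> g; rewrite /= -sec_gmeet -IH.
Qed.

Definition agree (F : seq P) (a b : D) : Prop :=
  foldr (fun A Q => (pr A a <-> pr A b) /\ Q) True F.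

Definition moves (F : seq P) : set D := [set x | exists a, agree F a (a * x)].

(** The set H X_F H of the outline, with H = [pr A] and X_F = [moves F]. *)
Definition thick (A : P) (F : seq P) : set D :=
  sprod (pr A) (sprod (moves F) (pr A)).

Definition denot (p : gform P G unit) : set D := [set x | sat_ p (fun _ => x)].

Lemma denot_prod p q : denot (gprod p q) = sprod (denot p) (denot q).
Proof.
apply/seteqP; split=> x; first by move=> [a [b [[? ?] ?]]]; exists a, b.
by move=> [a [b [? ? ?]]]; exists a, b.
Qed.

Lemma sat_gagree (I : Type) (F : seq P) (a b : I) (x : I -> D) :
  sat_ (gagree F a b) x <-> agree F (x a) (x b).
Proof.
elim: F => [//|A F IH]; rewrite /agree /= -/(agree _ _ _) -IH; split=> [[[? ?] ?]|[[? ?] ?]] //.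
Qed.

Lemma denot_moves F : denot (gmoves F) = moves F.
Proof.
apply/seteqP; split=> x; first by move=> [a [_ [/= <- /sat_gagree]]]; exists a.
by move=> [a h]; exists a, (a * x); split=> //; apply/sat_gagree.
Qed.

Lemma denot_thick A F : denot (gthick A F) = thick A F.
Proof. by rewrite /gthick !denot_prod denot_moves. Qed.

Lemma denot_pow4 p : denot (gpow4 p) = pow4 (denot p).
Proof. by rewrite /gpow4 !denot_prod. Qed.

Lemma agree_cat F F' a b : agree (F ++ F') a b <-> agree F a b /\ agree F' a b.
Proof.
elim: F => [|A F IH] /=; first by split=> // -[].
by rewrite /agree /= -!/(agree _ _ _) IH; split=> [[? []]|[[]]].
Qed.

Lemma agree_sym F a b : agree F a b -> agree F b a.
Proof. by elim: F => [//|A F IH] [h /IH]; split=> //; rewrite h. Qed.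

Lemma agree_refl F a : agree F a a.
Proof. by elim: F. Qed.

Lemma moves_sym F x : moves F x -> moves F x^-1.
Proof. by move=> [a /agree_sym h]; exists (a * x); rewrite mulgK. Qed.

Lemma thick_inv A F x : (forall y, pr A y -> pr A y^-1) ->
  thick A F x -> thick A F x^-1.
Proof.
move=> As [a [_ [/As Aa [b [d [/moves_sym Fb /As Ad <-]]] <-]]].
exists d^-1, (b^-1 * a^-1); split=> //; last by rewrite !invgM mulgA.
by exists b^-1, a^-1.
Qed.

Lemma moves_thick A F : pr A 1 -> moves F `<=` thick A F.
Proof.
move=> A1 x Fx; exists 1, x; split=> //; last by rewrite mul1g.
by exists x, 1; split=> //; rewrite mulg1.
Qed.

Lemma moves1 F : moves F 1.
Proof. by exists 1; rewrite mulg1; exact: agree_refl. Qed.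

(** The sets of [F] cut [Y] into finitely many atoms, and [s] takes a point in each nonempty one. *)
Lemma moves_generic F (Y : set D) : exists2 s : seq D,
  (forall a, a \in s -> Y a) & forall g, Y g -> exists2 a, a \in s & agree F a g.
Proof.
elim: F Y => [|A F IH] Y.
  have [[a Ya]|Y0] := pselect (exists a, Y a).
    exists [:: a]; first by move=> b; rewrite inE => /eqP->.
    by move=> g _; exists a; rewrite ?inE.
  by exists [::] => // g Yg; exfalso; apply: Y0; exists g.
have [s sY sP] := IH (Y `&` pr A); have [t tY tP] := IH (Y `\` pr A).
exists (s ++ t) => [a|g Yg]; first by rewrite mem_cat => /orP[/sY[]|/tY[]].
have [Ag|nAg] := pselect (pr A g).
  have [|a sa aP] := sP g; first by split.
  by exists a; rewrite ?mem_cat ?sa//; split=> //; have [] := sY _ sa.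
have [|a ta aP] := tP g; first by split.
by exists a; rewrite ?mem_cat ?ta ?orbT//; split=> //; have [] := tY _ ta.
Qed.

End Semantics.

End GroupFormulas.

Lemma sprodS (G : groupType) (A A' B B' : set G) :
  A `<=` A' -> B `<=` B' -> sprod A B `<=` sprod A' B'.
Proof. by move=> AA BB x [a [b [/AA ? /BB ? ?]]]; exists a, b. Qed.

Lemma pow4S (G : groupType) (A A' : set G) : A `<=` A' -> pow4 A `<=` pow4 A'.
Proof. by move=> AA; do 2 apply: sprodS => //; apply: sprodS. Qed.

Lemma sprod_sym (G : groupType) (A B : set G) x :
  (forall y, A y -> A y^-1)%g -> (forall y, B y -> B y^-1)%g ->
  sprod A B x -> sprod B A (x^-1)%g.
Proof.
move=> As Bs [a [b [/As ? /Bs ? <-]]]; exists (b^-1)%g, (a^-1)%g.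
by split=> //; rewrite invgM.
Qed.

Section DenotDefinable.
Context (L : language) (M C : structure L) (j : M -> C)
  (G K : groupType) (n : nat) (emb : G -> 'I_n -> M) (val : K -> 'I_n -> C) (c : G -> K).
Context (E : extension j emb val (fun a b d : G => (a * b)%g = d)
  (fun a b d : K => (a * b)%g = d) c).

(** One formula serves in both interpretations, so a definition found in G keeps its meaning in
    K. *)
Lemma denot_definable (p : gform (formula L ('I_n + M)) G unit) :
  exists phi, denot (pr_of idfun emb) id p = pr_of idfun emb phi /\
              denot (pr_of j val) c p = pr_of j val phi.
Proof.
exists (rename (fun v => match v with inl k => inl k.2 | inr m => inr m end) (ext_gtr E p)).
split; apply/seteqP; split=> x; rewrite /denot /pr_of /= satpE sat_rename.
- rewrite -/(gsatG _ _ _ _) -(sat_gtrG E) satpE.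
  by congr (sat _ _); apply: funext => -[].
- rewrite -/(gsatG _ _ _ _) -(sat_gtrG E) satpE.
  by congr (sat _ _); apply: funext => -[].
- rewrite -/(gsatK _ _ _ _ _) -(sat_gtrK E) satpE.
  by congr (sat _ _); apply: funext => -[].
- rewrite -/(gsatK _ _ _ _ _) -(sat_gtrK E) satpE.
  by congr (sat _ _); apply: funext => -[].
Qed.

End DenotDefinable.

(** * Thick sets whose eighth power lies in the fourth power of a given one *)

Section Absorption.
Context (R : realType) (L : language) (M C : structure L) (j : M -> C)
  (G K : groupType) (n : nat) (emb : G -> 'I_n -> M) (val : K -> 'I_n -> C) (c : G -> K).
Context (E : extension j emb val (fun a b d : G => (a * b)%g = d)
  (fun a b d : K => (a * b)%g = d) c).
Notation P := (formula L ('I_n + M)).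
Notation prG := (pr_of (idfun : M -> M) emb).
Local Open Scope group_scope.

Definition gdef (A : set G) : Prop := exists phi : P, A = prG phi.

Lemma gdef_denot (p : gform P G unit) : gdef (denot prG id p).
Proof. by have [phi []] := denot_definable E p; exists phi. Qed.

Context (OS : set P).
Hypothesis OS1 : forall A, OS A -> prG A 1.
Hypothesis OSM : forall A x y, OS A -> prG A x -> prG A y -> prG A (x * y).
Hypothesis OSV : forall A x, OS A -> prG A x -> prG A x^-1.
Hypothesis OST : OS !=set0.
Hypothesis OSI : forall A B, OS A -> OS B ->
  exists2 A', OS A' & prG A' `<=` prG A `&` prG B.
Hypothesis OSJ : forall A g, OS A -> 
  exists2 A', OS A' & prG A' `<=` [set x | prG A (g^-1 * x * g)].

(** Left invariance under a definable open subgroup makes the set of types containing X saturated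
    for the relation [~mu]. Hence X determines a subset of the quotient, which an invariant measure
    can evaluate. *)
Definition good (X : set G) : Prop := gdef X /\
  exists2 A, OS A & forall h x, prG A h -> X x -> X (h * x).

Lemma goodI X Y : good X -> good Y -> good (X `&` Y).
Proof.
move=> [[p ->] [A OA AX]] [[q ->] [B OB BY]]; split.
  have [r rE] := gdef_denot (GAnd (GIn p tt) (GIn q tt)).
  by exists r; rewrite -rE.
have [A' OA' A'P] := OSI OA OB; exists A' => // h x /A'P[Ah Bh] [Xx Yx].
by split; [apply: AX|apply: BY].
Qed.

Lemma goodC X : good X -> good (~` X).
Proof.
move=> [[p ->] [A OA AX]]; split.
  have [r rE] := gdef_denot (GNot (GIn p tt)).
  by exists r; rewrite -rE.
exists A => // h x Ah nX hX; apply: nX; rewrite -(mulKg h x).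
by apply: AX => //; exact: OSV.
Qed.

Lemma gdef_ltrans g X : gdef X -> gdef (ltrans g X).
Proof.
move=> [p ->].
have [r rE] := gdef_denot (GEx (GSub (fun v : option (option unit) =>
  match v with None => inr g | Some w => inl w end)
   (GAnd (GIn p (Some None)) (GMul None (Some None) (Some (Some tt)))))).
exists r; rewrite -rE; apply/seteqP; split=> x.
  by move=> px; exists (g^-1 * x); split=> //=; rewrite mulVKg.
by move=> [y [py /= yx]]; rewrite /ltrans /= -yx mulKg.
Qed.

(** If X is left-invariant under A, then gX is so under the conjugate g A g^-1, which contains a
    member of [OS] by [OSJ]. *)
Lemma good_ltrans g X : good X -> good (ltrans g X).
Proof.
move=> [dX [A OA AX]]; split; first exact: gdef_ltrans.
have [A' OA' A'P] := OSJ g OA; exists A' => // h x /A'P /= Ah Xx.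
have := AX _ _ Ah Xx.
by rewrite /ltrans /= !mulgA mulgK.
Qed.

Lemma good_sprod X Y : good X -> good Y -> good (sprod X Y).
Proof.
move=> [[p ->] [A OA AX]] [[q ->] _]; split.
  have [r rE] := gdef_denot (gprod (GIn p tt) (GIn q tt)).
  by exists r; rewrite -rE denot_prod.
exists A => // h x Ah [a [b [pa qb <-]]]; exists (h * a), b.
by rewrite mulgA; split=> //; apply: AX.
Qed.

Lemma good_thick A F : OS A -> good (thick prG A F).
Proof.
move=> OA; split.
  by have := gdef_denot (gthick G A F); rewrite denot_thick.
exists A => // h x Ah [a [b [Aa Xb <-]]]; exists (h * a), b.
by rewrite mulgA; split=> //; apply: OSM.
Qed.

Local Open Scope ring_scope.

Context (m : set G -> R).
Hypothesis m_ge0 : forall A, good A -> 0 <= m A.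
Hypothesis m_setT : m setT = 1.
Hypothesis m_add : forall A B, good A -> good B -> A `&` B = set0 ->
  m (A `|` B) = m A + m B.
Hypothesis m_ltrans : forall g A, good A -> m (ltrans g A) = m A.

Lemma goodT : good setT.
Proof.
split; first by have [r rE] := gdef_denot GTrue; exists r; rewrite -rE; apply/seteqP; split.
by have [A OA] := OST; exists A.
Qed.

Lemma good_le1 A : good A -> m A <= 1.
Proof.
by move=> gA; rewrite -m_setT; apply: (m_mono goodI goodC m_ge0 m_add) => //; exact: goodT.
Qed.

(** Every g agrees on [F] with one of finitely many representatives a, and then a^-1 g lies in
    [moves F]. So finitely many translates of the thick set cover G, which has measure 1. *)
Lemma thick_gt0 A F : OS A -> 0 < m (thick prG A F).
Proof.
move=> OA; have gA := good_thick F OA.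
have [s _ sP] := moves_generic prG F setT.
pose U (t : seq G) : set G := [set x | exists2 a, a \in t & ltrans a (thick prG A F) x].
have gU t : good (U t) /\ m (U t) <= (size t)%:R * m (thick prG A F).
  elim: t => [|a t [gt IH]].
    have -> : U [::] = set0 by apply/seteqP; split=> x // [].
    by rewrite (m_set0 goodI goodC m_add goodT) mul0r; split=> //; apply: (Good0 goodI goodC goodT).
  have -> : U (a :: t) = ltrans a (thick prG A F) `|` U t.
    apply/seteqP; split=> x.
      move=> [b]; rewrite inE => /predU1P[->|bt bx]; first by left.
      by right; exists b.
    move=> [ax|[b bt bx]]; first by exists a; rewrite ?inE ?eqxx.
    by exists b; rewrite ?inE ?bt ?orbT.
  have ga := good_ltrans a gA; split; first exact: (GoodU goodI goodC).
  apply: le_trans (m_subadd goodI goodC m_ge0 m_add ga gt) _.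
  by rewrite m_ltrans //= -natr1 mulrDl mul1r addrC lerD.
have UT : U s = setT.
  apply/seteqP; split=> // x _; have [//|a sa ax] := sP x.
  by exists a => //; apply: moves_thick; [exact: OS1|exists a; rewrite mulVKg].
have [_] := gU s; rewrite UT m_setT => h.
rewrite lt_neqAle (m_ge0 gA) andbT eq_sym; apply/eqP => m0.
by move: h; rewrite m0 mulr0 ler10.
Qed.

Local Open Scope group_scope.

(** After the Massicot-Wagner step it remains to place a thick set inside S^-1 S. Since [big] is
    first-order, S is definable; [A'] is a subgroup leaving B left-invariant, hence S
    right-invariant, and [F'] lists the translates g S which cover G. *)
Theorem absorption A F : OS A -> exists A' F', OS A' /\
  sprod (pow4 (thick prG A' F')) (pow4 (thick prG A' F')) `<=` pow4 (thick prG A F).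
Proof.
move=> OA; have gA := good_thick F OA.
have [|B [N [d [gB bB]]]] := massicot_wagner goodI goodC good_ltrans good_sprod m_ge0
  good_le1 m_add m_ltrans gA (thick_gt0 F OA); first by move=> x; apply: thick_inv => y; exact: OSV.
move=> /=; set S := [set g | _] => WA.
have [[p pE] [A' OA' A'B]] := gB.
have dS : gdef S.
  pose B0 : gform P G (option void) := GIn p None.
  have [r rE] := gdef_denot (GSub (fun _ => inl tt) (gbig N d (gmeet B0))).
  exists r; rewrite -rE; apply/seteqP.
  suff h g : denot prG id (GSub (fun _ => inl tt) (gbig N d (gmeet B0))) g <-> S g.
    by split=> g /h.
  rewrite /denot /= (_ : (fun _ => g) = fun v => oapp (fun w : void => match w with end) g v).
    by rewrite sat_gbig sec_gmeet /S /= pE.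
  by apply: funext => -[[]|].
have [s sP] := tcover_seq bB.
have /choice[f fP] : forall g, exists phi, ltrans g S = prG phi.
  by move=> g; exact: gdef_ltrans.
exists A', (map f s); split=> //; apply: subset_trans WA.
suff h : thick prG A' (map f s) `<=` quot S by apply: sprodS; apply: pow4S.
have SR g h : prG A' h -> S g -> S (g * h).
  move=> A'h; rewrite /S /= -ltransM.
  have -> // : ltrans h B = B.
  apply/seteqP; split=> x Bx; last by apply: A'B => //; exact: OSV.
  by rewrite -(mulVKg h x); apply: A'B.
move=> _ [h [_ [A'h [x [h' [[a ax] A'h' <-]]] <-]]].
(* [a] lies in some translate g S of the cover; [a x] agrees with it on [F'] and so lies in the same
   translate. *)
have [[]|[g gs gaS]] := sP a.
have gaxS : S (g^-1 * (a * x)).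
  suff : ltrans g S (a * x) by [].
  have : ltrans g S a by [].
  rewrite fP; elim: (s) gs ax => [//|g' s' IH].
  rewrite inE => /predU1P[<-|gs'] [gg ax']; last exact: IH.
  by apply: gg.1.
(* h x h' = (g^-1 a h^-1)^-1 (g^-1 a x h'), and both elements belong to S by its right invariance
   under [A']. *)
exists (g^-1 * a * h^-1), (g^-1 * (a * x) * h'); split.
- by apply: SR => //; exact: OSV.
- exact: SR.
- by rewrite !invgM !invgK !mulgA mulgK mulgVK.
Qed.

End Absorption.

(** * Open sets and infinitesimals *)

Section TopologicalSide.
Context (L L' : language) (i : sublanguage L L') (M C : structure L') (j : M -> C).
Context (G : definable_group (reduct i M)).
Notation n := (dg_dim G).
Notation emb := (@dg_emb _ _ G).
Notation ML := (reduct i M).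
Notation CL := (reduct i C).
Notation P := (formula L ('I_n + ML)).
Notation P' := (formula L' ('I_n + M)).
Context (K : groupType) (val : K -> 'I_n -> C) (c : G -> K).
Context (GE : group_extension j val c).
Notation mulG := (fun a b d : G => (a * b)%g = d).
Notation mulK := (fun a b d : K => (a * b)%g = d).
Context (E : @extension L ML CL j G K n emb val mulG mulK c).
Context (E' : @extension L' M C j G K n emb val mulG mulK c).
Notation prG := (@pr_of L ML n ML idfun G emb).
Notation prK := (@pr_of L ML n CL j K val).
Notation prG' := (@pr_of L' M n M idfun G emb).
Notation prK' := (@pr_of L' M n C j K val).

Lemma pr_lift (A : P) : prG' (lift_formula i A) = prG A /\ prK' (lift_formula i A) = prK A.
Proof. by split; apply/seteqP; split=> x; rewrite /pr_of /= => /satp_lift. Qed.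

Lemma star_of_val (A : P') (U : set G) x : U = prG' A ->
  star_of j U (val x) <-> prK' A x.
Proof.
move=> UA; rewrite /star_of (star_defines (ext_elem E') (phi := Conj A (ext_in E'))).
  rewrite satpE sat_Conj -!satpE (ext_inK E').
  by split=> [[]//|Ax]; split=> //; exists x.
apply/seteqP; split=> y.
  move=> [g Ug <-]; rewrite /= satpE sat_Conj -!satpE (ext_inG E').
  by split; [move: Ug; rewrite UA|exists g].
rewrite /= satpE sat_Conj -!satpE (ext_inG E') => -[Ay [g _ gy]].
by exists g; rewrite // UA /pr_of /= gy.
Qed.

Lemma star_of_range (U : set G) x : star_of j U x -> range val x.
Proof.
move=> [phi phiU hx].
rewrite -(ext_inK E'); apply: (elementary_sub (ext_elem E') (phi := phi)) hx => y hy.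
rewrite (ext_inG E').
have : [set x | satp (idfun : M -> M) phi x] y by [].
by rewrite -phiU => -[g _ <-]; exists g.
Qed.

Hypothesis openP : forall U : set G, open U -> exists r : rels L' n,
  [set x | rel_interp (s := M) r x] = emb @` U.

Lemma open_definable (U : set G) : open U -> exists A : P', U = prG' A.
Proof.
move=> /openP[r rU]; exists (Rel r (fun k => Var L' (inl k))).
apply/seteqP; split=> g.
  move=> Ug; have : (emb @` U) (emb g) by exists g.
  by rewrite -rU.
move=> h; have : [set x | rel_interp (s := M) r x] (emb g) by [].
by rewrite rU => -[g' Ug' /dg_emb_inj <-].
Qed.

Lemma star_of_sub (U V : set G) : open U -> open V -> U `<=` V ->
  star_of j U `<=` star_of j V.
Proof.
move=> /open_definable[A UA] /open_definable[B VB] UV x Ux.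
have [y _ xy] := star_of_range Ux; move: Ux; rewrite -xy (star_of_val _ UA) (star_of_val _ VB).
have := (gsat_transfer E' (GAll (GImp (GIn A None) (GIn B None)))
  (fun v : void => match v with end)).1.
by apply=> g /=; rewrite -/(prG' A g) -/(prG' B g) -UA -VB; apply: UV.
Qed.

(** The subgroups are kept as formulas of L, because each is used through both interpretations [prG]
    and [prK]. *)
Definition open_subgroup : set P := [set A | open (prG A) /\ 
  [/\ prG A 1%g, forall x y, prG A x -> prG A y -> prG A (x * y)%g &
      forall x, prG A x -> prG A (x^-1)%g]].

Hypothesis basisP : forall U : set G, nbhs (1%g : G) U -> exists H : set G,
     [/\ open H, group_closed [pred g | g \in H], definable (emb @` H) & H `<=` U].

Lemma open_subgroup_basis (U : set G) : nbhs (1%g : G) U ->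
  exists2 A, open_subgroup A & prG A `<=` U.
Proof.
move=> /basisP[H [oH [H1 HD] [A HA] HU]].
have HAE : prG A = H.
  apply/seteqP; split=> g.
    move=> Ag; have : [set x | satp (idfun : ML -> ML) A x] (emb g) by [].
    by rewrite -HA => -[h Hh /dg_emb_inj <-].
  move=> Hg; have : (emb @` H) (emb g) by exists g.
  by rewrite HA.
have GH : group_closed [pred g | g \in H] by [].
exists A; last by rewrite HAE.
rewrite /open_subgroup /= HAE; split=> //; split.
- by apply/set_mem.
- by move=> x y /mem_set Hx /mem_set Hy; apply/set_mem/(group_closedM GH).
- by move=> x /mem_set Hx; apply/set_mem/(group_closedV GH).
Qed.

Lemma mulg_left_continuous (g : G) : continuous (fun x : G => (g * x)%g).
Proof.
move=> x.
apply: (@continuous_comp _ _ _ (fun x : G => (g, x)) (fun p : G * G => (p.1 * p.2)%g)).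
  by apply: cvg_pair; [exact: cvg_cst|exact: cvg_id].
exact: mulg_continuous.
Qed.

Lemma mulg_right_continuous (g : G) : continuous (fun x : G => (x * g)%g).
Proof.
move=> x.
apply: (@continuous_comp _ _ _ (fun x : G => (x, g)) (fun p : G * G => (p.1 * p.2)%g)).
  by apply: cvg_pair; [exact: cvg_id|exact: cvg_cst].
exact: mulg_continuous.
Qed.

Lemma open_ltrans (g : G) (U : set G) : open U -> open (ltrans g U).
Proof.
move=> oU; have /continuousP := @mulg_left_continuous (g^-1)%g; exact.
Qed.

Lemma open_conj (g : G) (U : set G) : open U -> open [set x | U (g^-1 * x * g)%g].
Proof.
move=> oU; have /continuousP h := @mulg_right_continuous g.
exact: open_ltrans (h _ oU).
Qed.

Lemma open_sprod (U V : set G) : open U -> open (sprod U V).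
Proof.
move=> oU.
have -> : sprod U V = \bigcup_(v in V) [set x | U (x * v^-1)%g].
  apply/seteqP; split=> x; first by move=> [u [v [Uu Vv <-]]]; exists v => //=; rewrite mulgK.
  by move=> [v Vv /= Uv]; exists (x * v^-1)%g, v; rewrite mulgVK.
apply: bigcup_open => v _.
have /continuousP h := @mulg_right_continuous (v^-1)%g; exact: h.
Qed.

Lemma open_subgroupI A B : open_subgroup A -> open_subgroup B ->
  exists2 A', open_subgroup A' & prG A' `<=` prG A `&` prG B.
Proof.
move=> [oA [A1 _ _]] [oB [B1 _ _]]; apply: open_subgroup_basis.
by apply: open_nbhs_nbhs; split; [exact: openI|].
Qed.

Lemma open_subgroupJ A g : open_subgroup A ->
  exists2 A', open_subgroup A' & prG A' `<=` [set x | prG A (g^-1 * x * g)%g].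
Proof.
move=> [oA [A1 _ _]]; apply: open_subgroup_basis.
by apply: open_nbhs_nbhs; split; [exact: open_conj|rewrite /= mulg1 mulVg].
Qed.

Lemma open_subgroupT : open_subgroup !=set0.
Proof.
have [|A OA _] := @open_subgroup_basis setT; first exact: filterT.
by exists A.
Qed.

Lemma prK_subgroup A : open_subgroup A ->
  [/\ prK A 1%g, forall x y, prK A x -> prK A y -> prK A (x * y)%g &
      forall x, prK A x -> prK A (x^-1)%g].
Proof.
move=> [_ [A1 AM AV]].
have T := fun phi => (gsat_transfer E phi (fun v : void => match v with end)).1.
have M1 : forall x y z, prK A x -> prK A y -> (x * y = z)%g -> prK A z.
  refine (T (GAll (GAll (GAll (GImp (GIn A (Some (Some None))) (GImp (GIn A (Some None))
    (GImp (GMul (Some (Some None)) (Some None) None) (GIn A None))))))) _).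
  by move=> x y z /= Ax Ay <-; apply: AM.
(* Closure under right division; from a nonempty set it gives the identity and then the inverses. *)
have D1 : forall x y z, prK A y -> prK A x -> (z * y = x)%g -> prK A z.
  refine (T (GAll (GAll (GAll (GImp (GIn A (Some None)) (GImp (GIn A (Some (Some None)))
    (GImp (GMul None (Some None) (Some (Some None))) (GIn A None))))))) _).
  by move=> x y z /= Ay Ax xy; rewrite -(mulgK y z) xy; apply: AM => //; apply: AV.
have K1 : prK A 1%g.
  have [x Ax] : exists x, prK A x.
    by refine (T (GEx (GIn A None)) _); exists 1%g.
  by apply: (D1 x x 1%g) => //; rewrite mul1g.
by split=> // [x y Ax Ay|x Ax]; [apply: (M1 x y)|apply: (D1 1%g x); rewrite ?mulVg].
Qed.

(** The definable open subgroups form a basis at the identity. Thus [mu], defined with all open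
    neighbourhoods, is an intersection of sets definable in L. *)
Lemma mu_val x : mu j (G := G) (val x) <-> forall A, open_subgroup A -> prK A x.
Proof.
split=> [mx A [oA [A1 _ _]]|h U [oU U1]].
  rewrite -(pr_lift A).2; apply/(star_of_val _ erefl)/mx.
  by rewrite (pr_lift A).1.
have [|A OA AU] := @open_subgroup_basis U; first exact: open_nbhs_nbhs.
apply: (star_of_sub OA.1 oU AU).
by apply/(star_of_val x (esym (pr_lift A).1)); rewrite (pr_lift A).2; apply: h.
Qed.

End TopologicalSide.

(** * The invariant mean *)

Section TypeMeasure.
Context (R : realType) (kappa : Type).
Context (L L' : language) (i : sublanguage L L') (M C : structure L') (j : M -> C).
Context (G : definable_group (reduct i M)).
Notation n := (dg_dim G).
Notation emb := (@dg_emb _ _ G).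
Notation ML := (reduct i M).
Notation CL := (reduct i C).
Notation P := (formula L ('I_n + ML)).
Context (K : groupType) (val : K -> 'I_n -> C) (c : G -> K).
Context (GE : group_extension j val c).
Notation mulG := (fun a b d : G => (a * b)%g = d).
Notation mulK := (fun a b d : K => (a * b)%g = d).
Context (E : @extension L ML CL j G K n emb val mulG mulK c).
Notation prG := (@pr_of L ML n ML idfun G emb).
Notation prK := (@pr_of L ML n CL j K val).
Notation OS := (@open_subgroup L L' i M G).
Hypothesis mu_valP : forall x,
  mu j (G := G) (val x) <-> forall A, OS A -> prK A x.
Hypothesis smallM : card_lt [set: M] kappa.
Hypothesis satL : saturated kappa CL.

Lemma tp_complete (x : K) :
  @complete_type L ML _ [set phi : P | @satp L CL ML j _ phi (val x)].
Proof.
split=> [F Fx Ffin|phi]; last exact: EM.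
have [U [UU Ux]] := @coheir_filter L ML CL j n (val x) (ext_elem E).
by have [m hm] := filter_ex (finite_filterI _ Ffin (fun phi Fphi => Ux phi (Fx phi Fphi))); exists m.
Qed.

Lemma tp_concentrates (x : K) :
  exists2 phi : P, [set phi : P | @satp L CL ML j _ phi (val x)] phi &
                   defines phi (range emb).
Proof.
exists (ext_in E); first by apply/(ext_inK E); exists x.
by apply/seteqP; split=> y /(ext_inG E).
Qed.

Definition tp (x : K) : type_space G := TypeSpace (tp_complete x) (tp_concentrates x).

(** Saturation realises each type over the small model M, so points of the type space can be handled
    through elements of K. *)
Lemma type_space_tp (p : type_space G) : exists x, p = tp x.
Proof.
have pc := ts_complete p; have [fin compl] := pc.
have finC : @finitely_satisfiable L CL ML j _ (ts_type p).
  move=> F Fp Ffin; have [m hm] := fin F Fp Ffin; exists (j \o m) => phi Fphi.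
  by apply/(elem_satp E)/hm.
have [a ap] := saturated_realizes satL smallM finC.
have [phi pphi phiG] := ts_concentrates p.
have [x _ xa] : range val a.
  rewrite -(ext_inK E).
  apply: (elementary_sub (ext_elem E) (phi := phi)) (ap _ pphi) => y hy.
  by apply/(ext_inG E); rewrite phiG.
exists x; case: p pc fin compl finC ap {pphi phiG} => T Tc Tr /= _ _ compl _ ap.
have TE : T = [set phi : P | @satp L CL ML j _ phi (val x)].
  apply/seteqP; split=> psi; first by rewrite xa; exact: ap.
  move=> /= hpsi; have [//|/ap] := compl psi.
  by rewrite -xa => /(_ hpsi).
rewrite /tp; move: (tp_complete x) (tp_concentrates x); rewrite -TE => c1 c2.
by congr TypeSpace; exact: Prop_irrelevance.
Qed.

Lemma realizations_tp x a : realizations j (tp x) a ->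
  exists2 y, a = val y & forall phi, prK phi x <-> prK phi y.
Proof.
move=> ra; have [y _ ya] : range val a.
  by apply/(ext_inK E)/ra => /=; apply/(ext_inK E); exists x.
exists y => // phi; split=> [h|h]; first by rewrite /pr_of /= ya; exact: ra.
have := ra (Neg phi); rewrite -ya => nra; apply: contrapT => nh.
exact: nra nh h.
Qed.

Lemma realizations_refl x : realizations j (tp x) (val x).
Proof. by []. Qed.

Local Open Scope quotient_scope.
Notation S := (mu_type_space j G).
Notation pi_ x := (\pi_S (tp x)).
Notation goodG := (good emb OS).

Lemma mu1 : mu j (G := G) (val 1%g).
Proof. by apply/mu_valP => A OA; have [] := prK_subgroup E OA. Qed.

(** If the types of x and y are [~mu]-equivalent, then y = w z with w in [mu] and z of the same type
    as x. Left invariance of [phi] under A, transferred to K, absorbs w. *)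
Lemma pi_good (phi : P) x y : goodG (prG phi) -> pi_ x = pi_ y -> prK phi x -> prK phi y.
Proof.
move=> [_ [A OA Aphi]] /eqmodP/asboolP Exy hx.
have : setmul j (mu j (G := G)) (realizations j (tp y)) (val y).
  exists (val 1%g), (val y); split; [exact: mu1|exact: realizations_refl|].
  by apply/(ge_mul GE); rewrite mul1g.
rewrite -Exy => -[u [b [mu_u /realizations_tp[z -> xz] uby]]].
have [w _ wu] : range val u.
  rewrite (ge_range GE); have := mu_u setT; rewrite /Gstar; apply.
  by split; [exact: openT|].
rewrite -wu in mu_u uby; move/(ge_mul GE) in uby.
have : prK phi z by apply/xz.
have : prK A w by move/mu_valP: mu_u; apply.
move: w z y uby {Exy xz wu mu_u}.
refine ((gsat_transfer E (GAll (GAll (GAll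
  (GImp (GMul (Some (Some None)) (Some None) None)
  (GImp (GIn A (Some (Some None))) (GImp (GIn phi (Some None)) (GIn phi None)))))))
  (fun v : void => match v with end)).1 _).
by move=> h y z /= <- Ah py; apply: Aphi.
Qed.

(** The image in the quotient of the types containing X. Quantifying over the formulas defining X
    makes it a function of the set alone. *)
Definition clopen_of (X : set G) : set S :=
  [set y | exists phi x, [/\ X = prG phi, y = pi_ x & prK phi x]].

Lemma prK_ext phi psi x : prG phi = prG psi -> prK phi x -> prK psi x.
Proof.
move=> pp; move: x.
refine ((gsat_transfer E (GAll (GImp (GIn phi None) (GIn psi None)))
  (fun v : void => match v with end)).1 _).
by move=> g /=; rewrite -/(prG phi g) -/(prG psi g) pp.
Qed.

Lemma clopen_ofP phi x : goodG (prG phi) -> clopen_of (prG phi) (pi_ x) <-> prK phi x.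
Proof.
move=> gphi; split=> [[psi [y [pp xy hy]]]|hx]; last by exists phi, x.
by apply: (pi_good gphi (esym xy)); apply: prK_ext hy.
Qed.

Lemma pi_surj (y : S) : exists x, y = pi_ x.
Proof. by have [x xE] := type_space_tp (repr y); exists x; rewrite -xE reprK. Qed.

Lemma clopen_of_open X : goodG X -> open (clopen_of X).
Proof.
move=> gX; have [[phi XE] _] := gX; rewrite XE in gX *.
rewrite /open /= /quotient_open.
have -> : \pi_S @^-1` clopen_of (prG phi) = [set p : type_space G | ts_type p phi].
  apply/seteqP; split=> p; have [x ->] := type_space_tp p; rewrite /=.
    by move=> /(clopen_ofP _ gX).
  by move=> h; apply/(clopen_ofP _ gX).
exists [set [set p : type_space G | ts_type p phi]]; last by rewrite bigcup_set1.
move=> _ ->.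
apply: (@finI_from1 _ _ (range (fun phi => [set p : type_space G | ts_type p phi])) id).
by exists phi.
Qed.

Hypothesis OSI : forall A B, OS A -> OS B ->
  exists2 A', OS A' & prG A' `<=` prG A `&` prG B.
Hypothesis OSJ : forall A g, OS A ->
  exists2 A', OS A' & prG A' `<=` [set x | prG A (g^-1 * x * g)%g].

Lemma translate_clopen_of (g : G) X : goodG X ->
  translate g (clopen_of X) = clopen_of (ltrans g X).
Proof.
move=> gX; have [[phi XE] _] := gX; rewrite XE in gX *.
have [[psi psiE] _] := @good_ltrans _ _ _ _ _ _ _ _ _ _ E OS OSJ g _ gX.
have ggX := @good_ltrans _ _ _ _ _ _ _ _ _ _ E OS OSJ g _ gX.
rewrite psiE in ggX *.
have tr x y : (c g * x = y)%g -> prK phi x <-> prK psi y.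
  move: x y.
  refine ((gsat_transfer E (GAll (GAll (GSub (fun v : option (option (option void)) =>
     match v with None => inr g | Some w => inl w end)
     (GImp (GMul None (Some (Some None)) (Some None))
       (GAnd (GImp (GIn phi (Some (Some None))) (GIn psi (Some None)))
         (GImp (GIn psi (Some None)) (GIn phi (Some (Some None)))))))))
    (fun v : void => match v with end)).1 _) => x y /= <-.
  rewrite -/(prG phi x) -/(prG psi (g * x)%g) -psiE /ltrans /= mulKg.
  by split.
apply/seteqP; split=> y.
  move=> [p [q [Bp [a [b [pa gab qb]]] ->]]].
  have [x pE] := type_space_tp p; have [z qE] := type_space_tp q.
  rewrite {}pE in Bp pa; rewrite {}qE in qb *.
  move/(clopen_ofP _ gX) in Bp.
  have [x' ax' xx'] := realizations_tp pa; have [z' bz' zz'] := realizations_tp qb.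
  apply/(clopen_ofP _ ggX)/zz'.
  apply/(tr x' z'); last exact/xx'.
  by apply/(ge_mul GE); rewrite (ge_cst GE) -ax' -bz'.
have [z ->] := pi_surj y => /(clopen_ofP _ ggX) hz.
exists (tp ((c g)^-1 * z)%g), (tp z); split=> //.
  by apply/(clopen_ofP _ gX)/(tr _ z) => //; rewrite mulVKg.
exists (val ((c g)^-1 * z)%g), (val z); split; [exact: realizations_refl| |exact: realizations_refl].
have -> : Defs.constant j g = val (c g) by rewrite (ge_cst GE).
by apply/(ge_mul GE); rewrite mulVKg.
Qed.

Lemma OSV A x : OS A -> prG A x -> prG A (x^-1)%g.
Proof. by move=> [_ [_ _ h]]; exact: h. Qed.

Lemma clopen_ofU X Y : goodG X -> goodG Y -> goodG (X `|` Y) ->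
  clopen_of (X `|` Y) = clopen_of X `|` clopen_of Y.
Proof.
move=> gX gY gXY; have [[phi XE] _] := gX; have [[psi YE] _] := gY.
have [[chi UE] _] := gXY; rewrite UE in gXY *; rewrite XE in gX UE *; rewrite YE in gY UE *.
have h : forall x, prK chi x <-> prK phi x \/ prK psi x.
  refine ((gsat_transfer E (GAll (GAnd (GImp (GIn chi None) (GOr (GIn phi None) (GIn psi None)))
    (GImp (GOr (GIn phi None) (GIn psi None)) (GIn chi None))))
   (fun v : void => match v with end)).1 _) => g /=.
  by rewrite -/(prG chi g) -UE.
apply/seteqP; split=> y; have [x ->] := pi_surj y.
  by move=> /(clopen_ofP _ gXY)/h[?|?]; [left|right]; apply/clopen_ofP.
by move=> h'; apply/(clopen_ofP _ gXY)/h; case: h' => /clopen_ofP; [left|right]; auto.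
Qed.

Lemma clopen_of_disjoint X Y : goodG X -> goodG Y -> X `&` Y = set0 ->
  clopen_of X `&` clopen_of Y = set0.
Proof.
move=> gX gY; have [[phi XE] _] := gX; have [[psi YE] _] := gY.
rewrite XE in gX *; rewrite YE in gY * => XY.
have h : forall x, prK phi x -> prK psi x -> ~ True.
  refine ((gsat_transfer E (GAll (GImp (GIn phi None) (GImp (GIn psi None) (GNot GTrue))))
   (fun v : void => match v with end)).1 _) => g /= pg qg _.
  have : (prG phi `&` prG psi) g by [].
  by rewrite XY.
apply/seteqP; split=> // y; have [x ->] := pi_surj y.
by move=> [/(clopen_ofP _ gX) hx /(clopen_ofP _ gY) hy]; have := h x hx hy; apply.
Qed.

Lemma clopen_ofT : clopen_of setT = setT.
Proof.
apply/seteqP; split=> // y _; have [x ->] := pi_surj y.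
exists (ext_in E), x; split=> //; last by apply/(ext_inK E); exists x.
by apply/seteqP; split=> // g _; apply/(ext_inG E); exists g.
Qed.

Local Open Scope ring_scope.

(** The mean of X is the measure of [clopen_of X], which is open; [clopen_of] respects disjoint
    unions and left translates of good sets. *)
Lemma invariant_mean : definably_topologically_amenable j G R ->
  exists m : set G -> R, [/\
    forall A, goodG A -> 0 <= m A, m setT = 1,
    forall A B, goodG A -> goodG B -> A `&` B = set0 -> m (A `|` B) = m A + m B &
    forall g A, goodG A -> m (ltrans g A) = m A].
Proof.
move=> [nu nuP].
have mX X : goodG X -> (@open S).-sigma.-measurable (clopen_of X).
  by move=> gX; apply: sub_sigma_algebra; exact: clopen_of_open.
exists (fun X => fine (nu (clopen_of X))); split=> [A gA| |A B gA gB AB|g A gA].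
- exact/fine_ge0/measure_ge0.
- by rewrite clopen_ofT probability_setT.
- have gU : goodG (A `|` B) by apply: (GoodU (goodI E OSI) (goodC E OSV)).
  rewrite clopen_ofU// measureU ?fineD ?clopen_of_disjoint//; try exact: mX.
    by apply: fin_num_measure; exact: mX.
  by apply: fin_num_measure; exact: mX.
- by rewrite -translate_clopen_of// nuP//; exact: mX.
Qed.

End TypeMeasure.

(** * Cosets and compactness *)

Lemma automorphism_inv L (C : structure L) (s : C -> C) : automorphism s ->
  exists2 t : C -> C, automorphism t & cancel s t /\ cancel t s.
Proof.
move=> [[t ts st] sfun srel]; exists t; last by [].
have tE k (x : 'I_k -> C) : s \o (t \o x) = x by apply: funext => l /=; rewrite st.
split=> [|k f x|k r x]; first by exists s.
- by apply: (can_inj ts); rewrite st sfun tE.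
- by rewrite (srel _ _ (t \o x)) tE.
Qed.

Section Fixing.
Context (L : language) (M C : structure L) (j : M -> C).

Lemma fixing_satp s (V : Type) (phi : formula L (V + M)) (x : V -> C) : fixing j s ->
  satp j phi x <-> satp j phi (s \o x).
Proof.
move=> [saut sj]; rewrite !satpE (automorphism_sat saut).
by have -> : s \o vapp x j = vapp (s \o x) j by apply: funext => -[v|m] //=; rewrite sj.
Qed.

(** One inclusion is enough, since the inverse of an automorphism fixing M also fixes M. *)
Lemma invariantI (V : Type) (H : set (V -> C)) :
  (forall s a, fixing j s -> H a -> H (s \o a)) -> Defs.invariant j H.
Proof.
move=> h s saut sj; apply/seteqP; split=> [_ [a Ha <-]|a Ha]; first by apply: h.
have [t taut [st ts]] := automorphism_inv saut.
exists (t \o a); last by apply: funext => v /=; rewrite ts.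
by apply: h => //; split=> // m; rewrite -{1}sj st.
Qed.

Lemma invariantE (V : Type) (H : set (V -> C)) s a :
  Defs.invariant j H -> fixing j s -> H a -> H (s \o a).
Proof. by move=> Hi [saut sj] Ha; rewrite -(Hi s saut sj); exists a. Qed.

Lemma type_definable_invariant (V : Type) (H : set (V -> C)) :
  type_definable j H -> Defs.invariant j H.
Proof.
move=> [Phi ->]; apply: invariantI => s a sf ha phi Pphi.
by apply: (fixing_satp phi a sf).1; exact: ha.
Qed.

End Fixing.

(** * Bounded index and types over M; factorisations by compactness *)

Section Cosets.
Context (kappa : Type) (L : language) (M C : structure L) (j : M -> C)
  (G K : groupType) (n : nat) (emb : G -> 'I_n -> M) (val : K -> 'I_n -> C) (c : G -> K).
Context (E : extension j emb val (fun a b d : G => (a * b)%g = d)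
  (fun a b d : K => (a * b)%g = d) c).
Hypothesis kappaP : strong_limit kappa.
Hypothesis smallM : card_lt [set: M] kappa.
Hypothesis monC : monster kappa j.
Notation P := (formula L ('I_n + M)).
Notation prG := (pr_of (idfun : M -> M) emb).
Notation prK := (pr_of j val).
Local Open Scope group_scope.

Definition closed_subgroup (S : set K) : Prop :=
  [/\ S 1, forall x y, S x -> S y -> S (x * y) & forall x, S x -> S x^-1].

Definition lcoset_of (S : set K) (x : K) : set ('I_n -> C) :=
  val @` [set y | S (x^-1 * y)].

Lemma cst1 : c 1 = 1.
Proof.
have h : (c 1 * c 1 = c 1)%g.
  by apply: (gsat_transfer E (GMul tt tt tt) (fun _ => 1)).1; rewrite /gsatG /= mulg1.
by rewrite -[LHS](mulKg (c 1)) h mulVg.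
Qed.

Lemma fixing_act s : fixing j s -> exists f : K -> K,
  [/\ forall x, s \o val x = val (f x), forall x y, f (x * y) = f x * f y &
      forall g, f (c g) = c g].
Proof.
move=> sf.
have /choice[f fP] : forall x, exists y, s \o val x = val y.
  move=> x; have [y _ yE] : range val (s \o val x).
    by apply/(ext_inK E); apply: (fixing_satp _ _ sf).1; apply/(ext_inK E); exists x.
  by exists y.
exists f; split=> // [x y|g].
  apply/esym/(ext_mulK E); rewrite -!fP.
  have /(ext_mulK E) : x * y = x * y by [].
  move=> /(fixing_satp _ _ sf).
  congr (satp j _ _); apply: funext => -[[]|] //.
apply: (ext_val_inj E); rewrite -fP (ext_cst E).
by apply: funext => k /=; apply: sf.2.
Qed.

Lemma same_typeP x y : same_type j (val x) (val y) <-> forall phi : P, prK phi x <-> prK phi y.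
Proof. by []. Qed.

(** Lying in the same left coset of an invariant subgroup of bounded index is a bounded invariant
    equivalence relation; [Q] is this relation carried to tuples. *)
Lemma same_type_coset (S : set K) : closed_subgroup S ->
  (forall s x y, fixing j s -> s \o val x = val y -> S x -> S y) ->
  card_lt [set lcoset_of S x | x in setT] kappa ->
  forall x y, same_type j (val x) (val y) -> S (x^-1 * y).
Proof.
move=> [S1 SM SV] Sinv Sbdd x y xy.
pose Q (a b : 'I_n -> C) := exists u v, [/\ a = val u, b = val v & S (u^-1 * v)].
have vi := ext_val_inj E.
have QP u v : Q (val u) (val v) <-> S (u^-1 * v).
  by split=> [[u' [v' [/vi -> /vi -> //]]]|h]; exists u, v.
suff : Q (val x) (val y) by move/QP.
have Dx : range val (val x) by exists x.
apply: (bounded_invariant_same_type kappaP smallM monC (D := range val) (E := Q)) xy => //.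
- by move=> a b ab /(ext_inK E)/ab/(ext_inK E).
- by move=> _ [u _ <-]; apply/QP; rewrite mulVg.
- by move=> _ _ [u _ <-] [v _ <-] /QP/SV h; apply/QP; rewrite invgM invgK in h.
- move=> _ _ _ [u _ <-] [v _ <-] [w _ <-] /QP uv /QP vw; apply/QP.
  by have := SM _ _ uv vw; rewrite mulgA mulgK.
- move=> s _ _ sf [u _ <-] [v _ <-] /QP uv.
  have [f [fv fM fc]] := fixing_act sf; rewrite !fv; apply/QP.
  have f1 : f 1 = 1 by rewrite -cst1 fc.
  have <- : f (u^-1 * v) = (f u)^-1 * f v.
    by rewrite fM; congr (_ * _); apply: (mulgI (f u)); rewrite -fM !mulgV.
  exact: Sinv (fv _) uv.
- suff -> : [set [set b | range val b /\ Q a b] | a in range val] =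
            [set lcoset_of S x | x in setT] by [].
  have cE u : [set b | range val b /\ Q (val u) b] = lcoset_of S u.
    apply/seteqP; split=> [_ [[v _ <-] /QP h]|_ [v h <-]]; first by exists v.
    by split; [exists v|apply/QP].
  apply/seteqP; split=> [_ [_ [u _ <-] <-]|_ [u _ <-]]; rewrite ?cE; first by exists u.
  by exists (val u); [exists u|rewrite cE].
Qed.

(** The coset of [x] depends only on its type over M, which is coded by the family [T x] of subsets
    of G. There are at most 2^(2^|G|) such families, and [kappa] is a strong limit. *)
Lemma bounded_cosets (S : set K) : closed_subgroup S ->
  (forall x y, same_type j (val x) (val y) -> S (x^-1 * y)) ->
  card_lt [set lcoset_of S x | x in setT] kappa.
Proof.
move=> [S1 SM SV] SP.
pose T (x : K) : set (set G) := [set Z | exists2 phi : P, Z = prG phi & prK phi x].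
have TP x y : T x = T y -> S (x^-1 * y).
  move=> Txy; apply: SP; apply/same_typeP.
  have h : forall u v, T u = T v -> forall phi : P, prK phi u -> prK phi v.
    move=> u v Tuv phi pu; have : T u (prG phi) by exists phi.
    rewrite Tuv => -[psi pp]; move: v {Tuv}.
    refine ((gsat_transfer E (GAll (GImp (GIn psi None) (GIn phi None)))
      (fun v : void => match v with end)).1 _) => g /=.
    by rewrite -/(prG phi g) -/(prG psi g) pp.
  by move=> phi; split; apply: h.
have /choice[f fP] : forall q, exists x, [set lcoset_of S x | x in setT] q -> q = lcoset_of S x.
  by move=> q; have [[x _ <-]|nq] := pselect ([set lcoset_of S x | x in setT] q);
    [exists x|exists 1].
have smG : card_lt [set: G] kappa.
  by apply: (small_inj (ext_emb_inj E)); apply: small_fun => //; exact: small_ord.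
have smT := small_set kappaP (small_set kappaP smG).
apply: card_lt_le smT; apply: (@card_le_inj _ _ _ (T \o f)).
move=> q q' /set_mem Qq /set_mem Qq' /= /TP h.
rewrite (fP _ Qq) (fP _ Qq'); apply/seteqP; split=> _ [y Sy <-]; exists y => //=.
  rewrite -[y](mulVKg (f q)) mulgA; apply: SM => //.
  by move: (SV _ h); rewrite invgM invgK.
by rewrite -[y](mulVKg (f q')) mulgA; apply: SM.
Qed.

Definition fiber_var (v : option unit * 'I_n + M) : 'I_n + ('I_n + M) := match v with
  | inl (None, k) => inl k | inl (Some _, k) => inr (inl k) | inr m => inr (inr m) end.

Lemma sat_gfiber (psi : gform P G (option unit)) x y :
  sat (rename fiber_var (ext_gtr E psi)) (vapp (val y) (vapp (val x) j)) <->
  gfiber prK (fun u v w : K => u * v = w) c psi (fun _ => x) y.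
Proof.
rewrite sat_rename.
have -> : vapp (val y) (vapp (val x) j) \o fiber_var =
    vapp (flat val (fun v => oapp (fun _ : unit => x) y v)) j.
  by apply: funext => -[[[u|] k]|m].
exact: (sat_gtrK E psi (fun v => oapp (fun _ : unit => x) y v)).
Qed.

Section Compactness.
Context (x : K).

(** Compactness for a downward directed family of nonempty definable sets. The filter [F] which they
    generate shows that the type [p] is finitely satisfiable, and saturation realises [p]. *)
Lemma directed_realized (I : Type) (D : set I) (psi : I -> gform P G (option unit)) :
  D !=set0 ->
  (forall a b, D a -> D b -> exists2 d, D d &
    gfiber prK (fun u v w : K => u * v = w) c (psi d) (fun _ => x) `<=`
    gfiber prK (fun u v w : K => u * v = w) c (psi a) (fun _ => x) `&`
    gfiber prK (fun u v w : K => u * v = w) c (psi b) (fun _ => x)) ->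
  (forall a, D a -> gfiber prK (fun u v w : K => u * v = w) c (psi a) (fun _ => x) !=set0) ->
  exists y, forall a, D a -> gfiber prK (fun u v w : K => u * v = w) c (psi a) (fun _ => x) y.
Proof.
pose sec a := gfiber prK (fun u v w : K => u * v = w) c (psi a) (fun _ => x).
move=> [a0 Da0] dir ne.
pose F := [set Z : set K | exists2 a, D a & sec a `<=` Z].
have FF : ProperFilter F.
  apply: Build_ProperFilter_ex => [Z [a Da aZ]|].
    by have [y ay] := ne a Da; exists y; apply: aZ.
  split; first by exists a0.
  - move=> Y Z [a Da aY] [b Db bZ]; have [d Dd dab] := dir _ _ Da Db.
    by exists d => // y /dab[/aY ? /bZ ?].
  - by move=> Y Z YZ [a Da aY]; exists a => // y /aY/YZ.
have [_ satC _] := monC.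
pose h (v : 'I_n + M) : 'I_n + ('I_n + M) := match v with
  | inl k => inl k | inr m => inr (inr m) end.
have gP a y := sat_gfiber (psi a) x y.
have hP y : sat (rename h (ext_in E)) (vapp y (vapp (val x) j)) <-> range val y.
  rewrite sat_rename -(ext_inK E) satpE.
  suff -> : vapp y (vapp (val x) j) \o h = vapp y j by [].
  by apply: funext => -[].
pose p := [set rename h (ext_in E)] `|` [set rename fiber_var (ext_gtr E (psi a)) | a in D].
have [||y yp] := saturated_realizes satC (x := vapp (val x) j) (p := p).
- by apply: small_sum => //; exact: small_ord.
- move=> Z Zp Zfin.
  have [|y hy] := filter_ex (finite_filterI (U := F)
    (D := fun phi => [set y | sat phi (vapp (val y) (vapp (val x) j))]) _ Zfin _).
    move=> phi /Zp[->|[a Da <-]].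
      by exists a0 => // y _; apply/hP; exists y.
    by exists a => // y /gP.
  by exists (val y).
have [z _ zy] : range val y by apply/hP; apply: yp; left.
exists z => a Da; apply/gP; rewrite zy; apply: yp; right; exists a => //.
Qed.

End Compactness.

(** If [x] factors at every index, it has one factorisation valid for all of them: compactness is
    applied to the conditions on y that [p a] holds at y and [q a] at y^-1 x. *)
Lemma directed_sprod (I : Type) (D : set I) (p q : I -> gform P G unit) x :
  D !=set0 ->
  (forall a b, D a -> D b -> exists2 d, D d &
    denot prK c (p d) `<=` denot prK c (p a) `&` denot prK c (p b) /\
    denot prK c (q d) `<=` denot prK c (q a) `&` denot prK c (q b)) ->
  (forall a, D a -> sprod (denot prK c (p a)) (denot prK c (q a)) x) ->
  exists y z, [/\ y * z = x, forall a, D a -> denot prK c (p a) y &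
                  forall a, D a -> denot prK c (q a) z].
Proof.
move=> D0 dir h.
pose psi a : gform P G (option unit) :=
  GAnd (GSub (fun _ => inl None) (p a))
    (GEx (GAnd (GMul (Some None) None (Some (Some tt))) (GSub (fun _ => inl None) (q a)))).
have psiP a y : gfiber prK (fun u v w : K => u * v = w) c (psi a) (fun _ => x) y <->
    denot prK c (p a) y /\ denot prK c (q a) (y^-1 * x).
  split=> [[py [z [/= <- qz]]]|[py qy]]; first by rewrite mulKg.
  by split=> //; exists (y^-1 * x); split=> //=; rewrite mulVKg.
have [a b Da Db|a Da|y hy] := @directed_realized x I D psi D0.
- have [d Dd [dp dq]] := dir _ _ Da Db; exists d => // y /psiP[/dp[? ?] /dq[? ?]].
  by split; apply/psiP; split.
- have [y [z [py qz yz]]] := h a Da; exists y; apply/psiP.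
  by split=> //; rewrite -yz mulKg.
exists y, (y^-1 * x); split; first by rewrite mulVKg.
  by move=> a /hy/psiP[].
by move=> a /hy/psiP[].
Qed.

End Cosets.

(** * Connected components *)

Section Components.
Context (R : realType) (kappa : Type).
Context (L L' : language) (i : sublanguage L L') (M C : structure L') (j : M -> C).
Context (G : definable_group (reduct i M)).
Notation n := (dg_dim G).
Notation emb := (@dg_emb _ _ G).
Notation ML := (reduct i M).
Notation CL := (reduct i C).
Notation P := (formula L ('I_n + ML)).
Notation P' := (formula L' ('I_n + M)).
Context (K : groupType) (val : K -> 'I_n -> C) (c : G -> K).
Context (GE : group_extension j val c).
Notation mulG := (fun a b d : G => (a * b)%g = d).
Notation mulK := (fun a b d : K => (a * b)%g = d).
Context (E : @extension L ML CL j G K n emb val mulG mulK c).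
Context (E' : @extension L' M C j G K n emb val mulG mulK c).
Notation prG := (@pr_of L ML n ML idfun G emb).
Notation prK := (@pr_of L ML n CL j K val).
Notation prG' := (@pr_of L' M n M idfun G emb).
Notation prK' := (@pr_of L' M n C j K val).
Notation OS := (@open_subgroup L L' i M G).
Hypothesis kappaP : strong_limit kappa.
Hypothesis smallM : card_lt [set: M] kappa.
Hypothesis monC : monster kappa j.
Hypothesis monCL : @monster kappa L ML CL j.
Hypothesis openP : forall U : set G, open U -> exists r : rels L' n,
  [set x | rel_interp (s := M) r x] = emb @` U.
Hypothesis basisP : forall U : set G, nbhs (1%g : G) U -> exists H : set G,
  [/\ open H, group_closed [pred g | g \in H], definable (emb @` H) & H `<=` U].
Hypothesis amenable : definably_topologically_amenable j G R.

Local Open Scope group_scope.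

Let mu_valP := mu_val E' openP basisP.
Let OST := open_subgroupT basisP.
Let OSI := open_subgroupI basisP.
Let OSJ := open_subgroupJ basisP.
Let vi := ge_inj GE.

Lemma star_mul_range a b d : star_mul j (G := G) a b d ->
  [/\ range val a, range val b & range val d].
Proof.
move=> [phi phiD hx].
have sub (f : 'I_n -> 'I_n + 'I_n + 'I_n) (e : 'I_n -> C) :
    vapp (vapp a b) d \o f = e ->
    (forall g h : G, exists k : G, vapp (vapp (emb g) (emb h)) (emb (g * h)) \o f = emb k) ->
    range val e.
  move=> fe fG.
  have := @elementary_sub L' M C j (ext_elem E') ('I_n + 'I_n + 'I_n)%type phi
    (rename (fun v => match v with inl k => inl (f k) | inr m => inr m end) (ext_in E')).
  move=> /(_ _ _ hx); rewrite satpE sat_rename -(ext_inK E') -fe satpE.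
  suff -> : vapp (vapp (vapp a b) d) j \o (fun v => match v with inl k => inl (f k) | inr m => inr m end) =
    vapp (vapp (vapp a b) d \o f) j.
    apply=> x hxM; rewrite satpE sat_rename.
    have : [set x | satp (idfun : M -> M) phi x] x by [].
    rewrite -phiD => -[g [h ->]]; have [k kE] := fG g h.
    have /(ext_inG E') : range emb (emb k) by exists k.
    by rewrite -kE satpE; congr (sat _ _); apply: funext => -[].
  by apply: funext => -[].
split.
- by apply: (sub (inl \o inl)) => // g h; exists g.
- by apply: (sub (inl \o inr)) => // g h; exists h.
- by apply: (sub inr) => // g h; exists (g * h).
Qed.

Lemma setmul_val (A B : set ('I_n -> C)) :
  setmul j (G := G) A B = val @` sprod (val @^-1` A) (val @^-1` B).
Proof.
apply/seteqP; split=> d.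
  move=> [a [b [Aa Bb h]]]; have [[x _ xa] [y _ yb] [z _ zd]] := star_mul_range h.
  exists z => //; exists x, y; split; rewrite /= ?xa ?yb//.
  by apply/(ge_mul GE); rewrite xa yb zd.
move=> [_ [x [y [Ax By <-]]] <-]; exists (val x), (val y); split=> //.
exact/(ge_mul GE).
Qed.

Lemma preimage_val (S : set K) : val @^-1` (val @` S) = S.
Proof.
apply/seteqP; split=> x; first by move=> [y Sy /vi <-].
by exists x.
Qed.

Lemma val_one : val 1 = Defs.constant j (1 : G).
Proof. by rewrite -(cst1 E) (ge_cst GE). Qed.

Lemma closed_subgroupP (H : set ('I_n -> C)) : subgroup j (G := G) H ->
  closed_subgroup (val @^-1` H).
Proof.
move=> [_ H1 HM HV]; split; first by rewrite /= val_one.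
- by move=> x y Hx Hy; apply: (HM _ _ _ Hx Hy); apply/(ge_mul GE).
- by move=> x Hx; apply: (HV _ _ Hx); rewrite -val_one; apply/(ge_mul GE); rewrite mulgV.
Qed.

Lemma subgroup_val (S : set K) : closed_subgroup S -> subgroup j (G := G) (val @` S).
Proof.
move=> [S1 SM SV]; split.
- by move=> _ [x _ <-]; rewrite -(ge_range GE); exists x.
- by exists 1 => //; rewrite val_one.
- move=> _ _ d [x Sx <-] [y Sy <-] h; have [_ _ [z _ zd]] := star_mul_range h.
  by rewrite -zd in h *; exists z => //; move/(ge_mul GE): h => <-; apply: SM.
- move=> _ b [x Sx <-] h; have [_ [y _ yb] _] := star_mul_range h.
  rewrite -yb -val_one in h *; exists y => //; move/(ge_mul GE): h => h.
  by rewrite -(mulKg x y) h mulg1; apply: SV.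
Qed.

Lemma cosets_val (H : set ('I_n -> C)) :
  [set setmul j (G := G) [set a] H | a in Gstar j (G := G)] =
  [set lcoset_of val (val @^-1` H) x | x in setT].
Proof.
rewrite -(ge_range GE).
have hx x : setmul j (G := G) [set val x] H = lcoset_of val (val @^-1` H) x.
  rewrite setmul_val /lcoset_of; congr (_ @` _); apply/seteqP; split=> y.
    by move=> [_ [z [/vi -> Hz <-]]]; rewrite /= mulKg.
  by move=> Hy; exists x, (x^-1 * y); rewrite mulVKg.
apply/seteqP; split=> [_ [_ [x _ <-] <-]|_ [x _ <-]]; first by exists x; rewrite ?hx.
by exists (val x); [exists x|rewrite hx].
Qed.

Lemma bounded_val (S : set K) :
  card_lt [set lcoset_of val S x | x in setT] kappa ->
  bounded_index j (G := G) kappa (val @` S).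
Proof. by rewrite /bounded_index cosets_val preimage_val. Qed.

Lemma G000_M_type_definable : G000_M j (G := G) kappa `<=` G00_M j (G := G) kappa.
Proof.
move=> x hx H [[Hs Hb Ht] _]; apply: hx; split=> //; split=> //.
exact: type_definable_invariant.
Qed.

Lemma same_type_G000_M x y :
  @same_type L ML CL j n (val x) (val y) -> G000_M j (G := G) kappa (val (x^-1 * y)).
Proof.
move=> xy H [[Hs Hb Hi] _].
apply: (same_type_coset E kappaP smallM monCL (S := val @^-1` H) _ _ _ xy).
- exact: closed_subgroupP.
- by move=> s u v sf uv Hu; rewrite /= -uv; apply: invariantE sf Hu.
- by move: Hb; rewrite /bounded_index cosets_val.
Qed.

Definition K0 : set K :=
  [set x | forall A F, OS A -> pow4 (thick prK A F) x].

(** Closure under products is where amenability enters: [absorption] gives an inclusion in G which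
    is first-order and so passes to K. Inverses come from the symmetry of thick sets. *)
Lemma K0_subgroup : closed_subgroup K0.
Proof.
have thick1 A F : OS A -> thick prK A F 1.
  by move=> OA; have [A1 _ _] := prK_subgroup E OA; apply: moves_thick => //; exact: moves1.
split.
- by move=> A F /(thick1 A F) h; exists 1, 1; rewrite mulg1; split=> //; exists 1, 1; rewrite mulg1.
- move=> x y hx hy A F OA.
  have [m [m0 mT mA mt]] := invariant_mean GE E mu_valP smallM (let: And3 _ h _ := monCL in h)
    OSI OSJ amenable.
  have OS1 B : OS B -> prG B 1 by move=> [_ [? _ _]].
  have OSM B u v : OS B -> prG B u -> prG B v -> prG B (u * v).
    by move=> [_ [_ h _]]; exact: h.
  have [A' [F' [OA' sub]]] := absorption E OS1 OSM (@OSV _ _ _ _ _) OST OSI OSJ m0 mT mA mt F OA.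
  have subK : sprod (pow4 (thick prK A' F')) (pow4 (thick prK A' F')) `<=`
      pow4 (thick prK A F).
    pose p := gprod (gpow4 (gthick G A' F')) (gpow4 (gthick G A' F')).
    pose q := gpow4 (gthick G A F).
    have := (gsat_transfer E (GAll (GImp (GSub (fun _ => inl None) p) (GSub (fun _ => inl None) q)))
      (fun v : void => match v with end)).1.
    have pE (D : groupType) pr cc : denot pr cc p =
        sprod (pow4 (thick pr A' F')) (pow4 (thick (D := D) pr A' F')).
      by rewrite /p denot_prod !denot_pow4 !denot_thick.
    have qE (D : groupType) pr cc : denot pr cc q = pow4 (thick (D := D) pr A F).
      by rewrite /q !denot_pow4 !denot_thick.
    rewrite -(pE _ _ c) -(qE _ _ c); apply=> g.
    by move: (sub g); rewrite -(pE _ _ id) -(qE _ _ id).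
  by apply: subK; exists x, y; split=> //; [exact: hx|exact: hy].
- move=> x hx A F OA; have [_ _ AV] := prK_subgroup E OA.
  have tV y := @thick_inv _ K prK A F y AV.
  by apply: sprod_sym (hx A F OA) => y; apply: sprod_sym.
Qed.

Lemma pow4_thick_definable A F : exists phi : P,
  pow4 (thick prG A F) = prG phi /\ pow4 (thick prK A F) = prK phi.
Proof.
have [phi [h1 h2]] := denot_definable E (gpow4 (gthick G A F)).
by exists phi; rewrite -h1 -h2 !denot_pow4 !denot_thick.
Qed.

Lemma star_pow4_thick A F x :
  star_of j (pow4 (thick prG A F)) (val x) <-> pow4 (thick prK A F) x.
Proof.
have [phi [hG hK]] := pow4_thick_definable A F.
have [lG lK] := pr_lift j val phi.
by rewrite hK -lK; apply: (star_of_val E'); rewrite hG -lG.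
Qed.

Lemma same_type_K0 x y : @same_type L ML CL j n (val x) (val y) -> K0 (x^-1 * y).
Proof.
move=> xy A F OA; have [A1 _ _] := prK_subgroup E OA.
have T1 : thick prK A F 1 by apply: moves_thick => //; exact: moves1.
exists (x^-1 * y), 1; rewrite mulg1; split=> //; last by exists 1, 1; rewrite mulg1.
exists (x^-1 * y), 1; rewrite mulg1; split=> //; apply: moves_thick => //.
exists x; rewrite mulVKg; elim: F {T1} => [//|phi F IH]; split=> //; exact: xy.
Qed.

Lemma K0_bounded : bounded_index j (G := G) kappa (val @` K0).
Proof. exact/bounded_val/(bounded_cosets E kappaP smallM K0_subgroup same_type_K0). Qed.

Lemma G00_top_K0 : G00_top j (G := G) kappa `<=` val @` K0.
Proof.
apply: smallest_sub => //; split; [exact: subgroup_val K0_subgroup|exact: K0_bounded|].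
exists [set U | exists A F, OS A /\ U = pow4 (thick prG A F)].
  move=> _ [A [F [[oA _] ->]]].
  (* A product is open as soon as its left factor is, and the leftmost factor here is the open
     subgroup [prG A]. *)
  by apply: open_sprod; apply: open_sprod; apply: open_sprod.
apply/seteqP; split=> [_ [x hx <-] _ [A [F [OA ->]]]|a ha].
  by apply/star_pow4_thick/hx.
have [A OA] := OST.
have [x _ xa] : range val a by apply: (star_of_range E' (ha _ _)); exists A, [::].
exists x => // B F OB; apply/star_pow4_thick; rewrite xa; apply: ha.
by exists B, F.
Qed.

Lemma G00_M_K0 : G00_M j (G := G) kappa `<=` val @` K0.
Proof.
apply: smallest_sub => //; split; [exact: subgroup_val K0_subgroup|exact: K0_bounded|].
exists ([set ext_in E] `|` [set phi | exists A F, OS A /\ prK phi = pow4 (thick prK A F)]).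
apply/seteqP; split=> [_ [x hx <-] phi [->|[A [F [OA phiE]]]]|a ha].
- by apply/(ext_inK E); exists x.
- by have : prK phi x by rewrite phiE; exact: hx.
have [x _ xa] : range val a by apply/(ext_inK E); apply: ha; left.
exists x => // A F OA; have [phi [_ hK]] := pow4_thick_definable A F.
by rewrite hK /pr_of /= xa; apply: ha; right; exists A, F; rewrite hK.
Qed.

Lemma bigcap_closed_subgroup (Q : set (set ('I_n -> C))) (X : set ('I_n -> C)) :
  (forall H, Q H -> subgroup j (G := G) H) -> closed_subgroup (val @^-1` smallest Q X).
Proof.
move=> QS; have h H := fun QH : Q H => closed_subgroupP (QS H QH).
split=> [H [QH _]|x y hx hy H [QH XH]|x hx H [QH XH]].
- by have [? _ _] := h _ QH.
- by have [_ hM _] := h _ QH; apply: hM; [exact: hx|exact: hy].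
- by have [_ _ hV] := h _ QH; apply: hV; exact: hx.
Qed.

Lemma G000_top_subgroup : closed_subgroup (val @^-1` G000_top j (G := G) kappa).
Proof. by apply: bigcap_closed_subgroup => H []. Qed.

Lemma G000_M_subgroup : closed_subgroup (val @^-1` G000_M j (G := G) kappa).
Proof. by apply: bigcap_closed_subgroup => H []. Qed.

Lemma G000_top_normal g x : G000_top j (G := G) kappa (val x) ->
  G000_top j (G := G) kappa (val (g * x * g^-1)).
Proof.
move=> hx H [[Hs Hn Hb Hi] muH].
apply: (Hn (val g) (val x) _ (val (g * x))).
- by rewrite -(ge_range GE); exists g.
- exact: hx.
- exact/(ge_mul GE).
- by apply/(ge_mul GE); rewrite mulgVK.
Qed.

Definition N000 : set K :=
  sprod (val @^-1` G000_top j (G := G) kappa) (val @^-1` G000_M j (G := G) kappa).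

(** By normality of [G000_top], t m t' m' = t (m t' m^-1) (m m') has its first two factors in
    [G000_top]. *)
Lemma N000M x y : N000 x -> N000 y -> N000 (x * y).
Proof.
move=> [t [m [tT mM <-]]] [t' [m' [tT' mM' <-]]].
have [_ TM _] := G000_top_subgroup; have [_ MM _] := G000_M_subgroup.
exists (t * (m * t' * m^-1)), (m * m'); split; last by rewrite !mulgA mulgVK.
- by apply: TM => //; exact: G000_top_normal.
- exact: MM.
Qed.

Lemma mu_N000 x : (forall A, OS A -> prK A x) -> N000 x.
Proof.
move=> hx; have [M1 _ _] := G000_M_subgroup.
exists x, 1; rewrite mulg1; split=> // H [_ muH]; apply: muH; exact/mu_valP.
Qed.

Lemma G000_M_N000 x : G000_M j (G := G) kappa (val x) -> N000 x.
Proof.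
move=> hx; have [T1 _ _] := G000_top_subgroup.
by exists 1, x; rewrite mul1g.
Qed.

(** Compactness gives a single y such that y and y v agree on every finite family, that is, have the
    same type over M; then v = y^-1 (y v). *)
Lemma moves_G000_M v : (forall F, moves prK F v) -> G000_M j (G := G) kappa (val v).
Proof.
move=> hv.
pose psi F : gform P G (option unit) :=
  GEx (GAnd (GMul (Some None) (Some (Some tt)) None) (gagree G F (Some None) None)).
have psiP F y : gfiber prK mulK c (psi F) (fun _ => v) y <-> agree prK F y (y * v).
  split=> [[b [/= <- /sat_gagree//]]|h].
  by exists (y * v); split=> //; apply/sat_gagree.
have [|F F' _ _|F _|y hy] := @directed_realized kappa L ML CL j G K n emb val c E
    kappaP smallM monCL v (seq P) setT psi.
- by exists [::].
- exists (F ++ F') => // y /psiP/agree_cat[h h'].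
  by split; apply/psiP.
- by have [y h] := hv F; exists y; apply/psiP.
rewrite -(mulKg y v); apply: same_type_G000_M => phi.
by have /psiP[] := hy [:: phi] I.
Qed.

(** Compactness is used repeatedly on the pairs (A, F): an element of [K0] splits into two halves,
    each half into two elements of all thick sets, and each of these into an element of [mu], one of
    all [moves F] and one of [mu]. *)
Lemma K0_N000 : K0 `<=` N000.
Proof.
move=> x hx.
pose D : set (P * seq P) := [set a | OS a.1].
have D0 : D !=set0 by have [A OA] := OST; exists (A, [::]).
have dir a b : D a -> D b -> exists2 d, D d &
    prK d.1 `<=` prK a.1 `&` prK b.1 /\ moves prK d.2 `<=` moves prK a.2 `&` moves prK b.2.
  move=> Da Db; have [A' OA' sub] := OSI Da Db; exists (A', a.2 ++ b.2) => //; split.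
    refine ((gsat_transfer E (GAll (GImp (GIn A' None) (GAnd (GIn a.1 None) (GIn b.1 None))))
      (fun v : void => match v with end)).1 sub).
  by move=> y [u /agree_cat[h h']]; split; exists u.
pose A_ (a : P * seq P) : gform P G unit := GIn a.1 tt.
pose m_ (a : P * seq P) := gmoves G a.2.
pose t_ (a : P * seq P) := gthick G a.1 a.2.
have mE a : denot prK c (m_ a) = moves prK a.2 by exact: denot_moves.
have tE a : denot prK c (t_ a) = thick prK a.1 a.2 by exact: denot_thick.
have dirS (p q : P * seq P -> gform P G unit) :
    (forall d a, prK d.1 `<=` prK a.1 -> moves prK d.2 `<=` moves prK a.2 ->
       denot prK c (p d) `<=` denot prK c (p a) /\ denot prK c (q d) `<=` denot prK c (q a)) ->
    forall x, (forall a, D a -> sprod (denot prK c (p a)) (denot prK c (q a)) x) ->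
    exists y z, [/\ y * z = x, forall a, D a -> denot prK c (p a) y &
                  forall a, D a -> denot prK c (q a) z].
  move=> mono z hz; apply: (directed_sprod E kappaP smallM monCL) hz => // a b Da Db.
  have [d Dd [dA dm]] := dir a b Da Db; exists d => //.
  have [pa qa] := mono d a (fun y hy => (dA y hy).1) (fun y hy => (dm y hy).1).
  have [pb qb] := mono d b (fun y hy => (dA y hy).2) (fun y hy => (dm y hy).2).
  by split=> y hy; split; auto.
have tS d a : prK d.1 `<=` prK a.1 -> moves prK d.2 `<=` moves prK a.2 ->
    thick prK d.1 d.2 `<=` thick prK a.1 a.2.
  by move=> h h'; do 2 apply: sprodS => //.
have thickN y : (forall a, D a -> denot prK c (t_ a) y) -> N000 y.
  move=> hy.
  have [d a h h'||u [z [<- hu hz]]] := dirS A_ (fun a => gprod (m_ a) (A_ a)) _ y.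
  - by split=> //; rewrite !denot_prod !mE; apply: sprodS.
  - by move=> a /hy; rewrite tE denot_prod mE.
  apply: N000M; first by apply: mu_N000 => A OA; exact: (hu (A, [::])).
  have [d a h h'||v [w [<- hv hw]]] := dirS m_ A_ _ z.
  - by split=> //; rewrite !mE.
  - by move=> a /hz; rewrite denot_prod.
  apply: N000M; last by apply: mu_N000 => A OA; exact: (hw (A, [::])).
  apply: G000_M_N000; apply: moves_G000_M => F; have [A OA] := OST.
  by have := hv (A, F) OA; rewrite mE.
have sE a : denot prK c (gprod (t_ a) (t_ a)) =
    sprod (thick prK a.1 a.2) (thick prK a.1 a.2) by rewrite denot_prod tE.
have squareN y : (forall a, D a -> denot prK c (gprod (t_ a) (t_ a)) y) -> N000 y.
  move=> hy.
  have [d a h h'||u [z [<- hu hz]]] := dirS t_ t_ _ y.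
  - by rewrite !tE; split; apply: tS.
  - by move=> a /hy; rewrite denot_prod.
  by apply: N000M; apply: thickN.
have [d a h h'||u [z [<- hu hz]]] := dirS (fun a => gprod (t_ a) (t_ a)) (fun a => gprod (t_ a) (t_ a)) _ x.
- by rewrite !sE; split; apply: sprodS; apply: tS.
- by move=> a Da; rewrite !sE; apply: hx.
by apply: N000M; apply: squareN.
Qed.

(** A subgroup H entering the definition of [G00_top] comes without normality. Its preimage S is
    replaced by the intersection [S'] of the conjugates of S by elements of G, which turns out to be
    normal in K and to satisfy all the requirements for [G000_top]. *)
Lemma G000_top_sub : G000_top j (G := G) kappa `<=` G00_top j (G := G) kappa.
Proof.
move=> b hb H [[Hs Hb [F Fo HF]] _].
pose S := val @^-1` H.
have [S1 SM SV] := closed_subgroupP Hs.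
have Finv s a : fixing j s -> H a -> H (s \o a).
  move=> sf; rewrite HF => ha U FU; have [phi phiU hphi] := ha U FU.
  by exists phi => //; apply: (fixing_satp phi a sf).1.
have SP x y : same_type j (val x) (val y) -> S (x^-1 * y).
  apply: (same_type_coset E' kappaP smallM monC) => //.
  - by move=> s u v sf uv Su; rewrite /S /= -uv; apply: Finv.
  - by move: Hb; rewrite /bounded_index cosets_val.
have SF x : S x <-> forall U (A : P'), F U -> U = prG' A -> prK' A x.
  rewrite /S /= HF; split=> [h U A FU UA|h U FU].
    by apply/(star_of_val E' x UA)/h.
  have [A UA] := open_definable openP (Fo U FU).
  by apply/(star_of_val E' x UA)/(h U).
pose S' : set K := [set x | forall g, S ((c g)^-1 * x * c g)].
have S'S : S' `<=` S by move=> x /(_ 1); rewrite (cst1 E) invg1 mul1g mulg1.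
have S'sub : closed_subgroup S'.
  split=> [g|x y hx hy g|x hx g].
  - by rewrite mulg1 mulVg.
  - by have := SM _ _ (hx g) (hy g); rewrite !mulgA mulgK.
  - by have := SV _ (hx g); rewrite !invgM invgK mulgA.
(* Right multiplication by an element of G preserves equality of types over M, because that element
   is named by parameters from M. *)
have S'P x y : same_type j (val x) (val y) -> S' (x^-1 * y).
  move=> xy g; have -> : (c g)^-1 * (x^-1 * y) * c g = (x * c g)^-1 * (y * c g).
    by rewrite invgM !mulgA.
  apply: SP => phi.
  have [psi [_ psiE]] := denot_definable E' (GEx (GAnd (GSub
    (fun v : option (option unit) => match v with None => inr g | Some w => inl w end)
     (GMul (Some (Some tt)) None (Some None))) (GIn phi None))).
  have h u : prK' phi (u * c g) <-> prK' psi u.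
    rewrite -psiE; split=> [pu|[w [/= <- pw]]]; last exact: pw.
    by exists (u * c g).
  by apply: (iff_trans (h x)); apply: iff_trans (iff_sym (h y)); exact: xy.
have S'inv s a : fixing j s -> (val @` S') a -> (val @` S') (s \o a).
  move=> sf [x hx <-]; have [f [fv fM fc]] := fixing_act E' sf.
  exists (f x); last by rewrite fv.
  have f1 : f 1 = 1 by rewrite -(cst1 E) fc.
  have fV u : f u^-1 = (f u)^-1 by apply: (mulgI (f u)); rewrite -fM !mulgV.
  by move=> g; rewrite -(fc g) -fV -!fM /S /= -fv; apply: Finv sf (hx g).
(* Each open U in [F] contains 1, because S does. So its conjugates by elements of G are open
   neighbourhoods of 1, whose interpretations contain [mu]. *)
have muS' : mu j (G := G) `<=` val @` S'.
  move=> a mua.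
  have [w _ wa] : range val a by apply: (star_of_range E' (mua setT _)); split=> //; exact: openT.
  exists w => // g; apply/SF => U A FU UA.
  have oU := Fo U FU.
  have U1 : U 1.
    rewrite UA; apply/(gsat_transfer E' (GIn A tt) (fun _ => 1)).
    rewrite /gsatK /= (cst1 E); exact: ((SF 1).1 S1 U A FU UA).
  have oV := open_conj g oU.
  have [B VB] := open_definable openP oV.
  have Bw : prK' B w.
    by apply/(star_of_val E' w VB); rewrite wa; apply: mua; split=> //=; rewrite mulg1 mulVg.
  have conjP : forall x y z, x * c g = z -> c g * y = z -> prK' B x -> prK' A y.
    refine ((gsat_transfer E' (GAll (GAll (GAll (GSub
      (fun v : option (option (option (option void))) => match v with None => inr g | Some w => inl w end)
      (GImp (GMul (Some (Some (Some None))) None (Some None))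
      (GImp (GMul None (Some (Some None)) (Some None))
      (GImp (GIn B (Some (Some (Some None)))) (GIn A (Some (Some None))))))))))
      (fun v : void => match v with end)).1 _) => x y z /= xz yz.
    rewrite -/(prG' B x) -/(prG' A y) -VB -UA /= -mulgA xz -yz mulKg //.
  by apply: (conjP w _ (w * c g)) => //; rewrite -mulgA mulVKg.
(* [u] is replaced by an element [z] of the same type over M, equal to [u] modulo
   [S], which is a coheir over [x]: then [z^-1 x z] inherits the properties of the
   conjugates of [x] by elements of G. *)
have key u x : S' x -> S (u^-1 * x * u).
  move=> hx; have [_ satC _] := monC.
  have [U [UU Uu]] := coheir_filter (val u) (ext_elem E').
  have [|cz hz] := coheir_realizes j satC (vapp (val x) j) UU.
    by apply: small_sum => //; exact: small_ord.
  have uz := coheir_same_type monC UU Uu hz.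
  have [z _ zE] : range val cz.
    by apply/(ext_inK E')/uz/(ext_inK E'); exists u.
  rewrite -{cz}zE in hz uz.
  have Suz : S (u^-1 * z) by exact: SP.
  have Sz : S (z^-1 * x * z).
    apply/SF => U0 A FU UA.
    pose psi : gform P' G (option unit) := GEx (GEx (GAnd (GAnd
      (GMul (Some (Some (Some tt))) (Some (Some None)) (Some None))
      (GMul (Some (Some None)) None (Some None))) (GIn A None))).
    have psiP y : gfiber prK' mulK c psi (fun _ => x) y <-> prK' A (y^-1 * x * y).
      split=> [[a1 [b1 [[/= xy yb] hb1]]]|h].
        by rewrite -mulgA xy -yb mulKg.
      by exists (x * y), (y^-1 * x * y); split=> //; split=> //=; rewrite -mulgA mulVKg.
    apply/psiP/(sat_gfiber E')/hz.
    apply: filterS (Uu (ext_in E') _); last by apply/(ext_inK E'); exists u.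
    move=> m /(ext_inG E')[g _ <-].
    have /(sat_gfiber E' psi) : gfiber prK' mulK c psi (fun _ => x) (c g).
      by apply/psiP; exact: ((SF _).1 (hx g) U0 A FU UA).
    by rewrite (ext_cst E').
  have -> : u^-1 * x * u = (u^-1 * z) * (z^-1 * x * z) * (u^-1 * z)^-1.
    by rewrite invgM invgK !mulgA mulgK mulgK.
  by apply: (SM _ _ _ (SV _ Suz)); exact: SM.
suff [x Sx <-] : (val @` S') b by exact: S'S Sx.
apply: hb; split=> //; split.
- exact: subgroup_val.
- move=> a _ k d _ [x hx <-] h1 h2.
  have [[u _ uE] _ [w _ wE]] := star_mul_range h1; have [[y _ yE] _ _] := star_mul_range h2.
  rewrite -{}uE -{}wE -{k}yE in h1 h2 *.
  move/(ge_mul GE): h1 => ux; move/(ge_mul GE): h2 => yu.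
  (* With y = u^-1 x u, the conjugate of y by [c g] is the conjugate of x by u^-1 (c g), an element
     of K to which [key] applies. *)
  exists y => // g; have := key (u^-1 * c g) x hx.
  by rewrite -[y](mulgK u) yu -ux invgM invgK !mulgA.
- exact/bounded_val/(bounded_cosets E' kappaP smallM).
- exact: invariantI.
Qed.

Theorem G00_def_top_eq :
  G00_def_top j (G := G) kappa = G000_def_top j (G := G) kappa.
Proof.
apply/seteqP; split=> d; rewrite /G00_def_top /G000_def_top; last first.
  move=> [a [b [Ta Mb h]]]; exists a, b; split=> //; first exact: G000_top_sub.
  exact: G000_M_type_definable.
move=> [_ [_ [/G00_top_K0[x hx <-] /G00_M_K0[y hy <-] h]]].
rewrite setmul_val; have [_ _ [z _ zE]] := star_mul_range h.
rewrite -{d}zE in h *; move/(ge_mul GE): h => <-; exists (x * y) => //.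
by apply: K0_N000; have [_ KM _] := K0_subgroup; apply: KM.
Qed.

End Components.

Theorem theorem1p5 (R : realType) (L L' : language) (i : sublanguage L L')
    (M C : structure L') (j : M -> C) (kappa : Type)
    (G : definable_group (reduct i M)) :
  hausdorff_space G ->
  (forall U : set G, open U -> exists r : rels L' (dg_dim G),
     [set x | rel_interp (s := M) r x] = (@dg_emb _ _ G) @` U) ->
  strong_limit kappa ->
  card_lt [set: M] kappa ->
  card_lt [set: symbols L'] kappa ->
  monster kappa j ->
  @monster kappa L (reduct i M) (reduct i C) j ->
  (forall U : set G, nbhs (1%g : G) U -> exists H : set G,
     [/\ open H, group_closed [pred g | g \in H],
         definable ((@dg_emb _ _ G) @` H) & H `<=` U]) ->
  definably_topologically_amenable j G R ->
  G00_def_top j (G := G) kappa = G000_def_top j (G := G) kappa.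
Proof.
move=> _ openP kappaP smallM _ monC monCL basisP amen.
have eL : @elementary L (reduct i M) (reduct i C) j by case: monCL.
have eL' : elementary j by case: monC.
(* [G^*] is made into a group K; [E] and [E'] then provide transfer from G to K in L and in L'. *)
have [K [val [c GE]]] := @group_extension_exists L L' i M C j eL' G eL.
have [E] := @extension_of_star L L' i M C j eL' G K val _ c eL (ge_inj GE)
  (ge_range GE) (ge_mul GE) (ge_cst GE).
have E' := extension_lift eL' E.
exact: (G00_def_top_eq GE E E' kappaP smallM monC monCL openP basisP amen).
Qed.
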